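(* Every PTC vector field $F$ on $D^2$ is parameter rigid: for any $C^\infty$ vector field $F'$ on $D^2$ such that every orbit of $F'$ is included in some orbit of $F$, there exists a $C^\infty$ function $\nu:D^2\to\mathbb{R}$ such that $F'=\nu F$.
   Context: $D^2\subset\mathbb{R}^2$ is the closed unit disk centered at the origin $O$. A $C^\infty$ vector field $F$ on $D^2$ is called a TC vector field if (T1) $F$ is tangent to $\partial D^2$; (T2) $O$ is the unique singular point (zero) of $F$; (T3) all other orbits of $F$ are closed (i.e. periodic). Its period function $\theta:D^2\setminus\{O\}\to(0,+\infty)$ associates to each $z\neq O$ its period with respect to $F$. A TC vector field is called PTC if $\theta$ extends to a $C^\infty$ function on all of $D^2$. *)

(* Defs.v *)
From Stdlib Require Import Reals.
From Coquelicot Require Import Coquelicot.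
Open Scope R_scope.

(* Functions, vector fields and curves on the disk are total functions; only
   their values on [disk] are ever used. *)

Definition origin : R * R := (0, 0).

Definition disk (p : R * R) : Prop := fst p ^ 2 + snd p ^ 2 <= 1.

Definition circle (p : R * R) : Prop := fst p ^ 2 + snd p ^ 2 = 1.

(* Smoothness on a manifold with boundary: near each point of the closed disk,
   [f] agrees on the disk with a function having continuous partial derivatives
   of all orders on a neighbourhood of that point in R^2. *)
Definition smooth (f : R * R -> R) : Prop :=
  forall p, disk p ->
  exists g : R -> R -> R,
    locally p (fun q =>
      (forall n, ex_diff_n g n (fst q) (snd q)) /\
      (disk q -> f q = g (fst q) (snd q))).

Definition vector_field : Type := R * R -> R * R.

Definition smooth_vector_field (X : vector_field) : Prop :=
  smooth (fun p => fst (X p)) /\ smooth (fun p => snd (X p)).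

Definition is_interval (I : R -> Prop) : Prop :=
  forall a b t, I a -> I b -> a <= t <= b -> I t.

(* [gamma] takes values in the disk on [I] and solves gamma' = X(gamma) there.
   This is [is_derive] with the neighbourhood filter restricted to [I], so that
   the derivative is one-sided at an endpoint of [I] belonging to [I] (an orbit
   may start or end on the boundary of the disk). *)
Definition integral_curve (X : vector_field) (I : R -> Prop)
    (gamma : R -> R * R) : Prop :=
  forall t, I t ->
    disk (gamma t) /\
    filterdiff gamma (within I (locally t)) (fun h : R => scal h (X (gamma t))).

(* The orbit of [p], as a subset of the disk: the union of the images of all the
   integral curves with gamma(0) = p. By uniqueness of solutions these curves
   are the restrictions of the maximal one, so this union is its image. *)
Definition orbit (X : vector_field) (p : R * R) : R * R -> Prop :=
  fun q => exists (I : R -> Prop) (gamma : R -> R * R) (t : R),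
    is_interval I /\ I 0 /\ I t /\ integral_curve X I gamma /\
    gamma 0 = p /\ gamma t = q.

Definition complete_curve (X : vector_field) (p : R * R)
    (gamma : R -> R * R) : Prop :=
  integral_curve X (fun _ => True) gamma /\ gamma 0 = p.

Definition closed_orbit (X : vector_field) (p : R * R) : Prop :=
  exists gamma T, complete_curve X p gamma /\
    0 < T /\ forall t, gamma (t + T) = gamma t.

(* The period is the least positive one. *)
Definition is_period (X : vector_field) (p : R * R) (T : R) : Prop :=
  exists gamma, complete_curve X p gamma /\
    0 < T /\ (forall t, gamma (t + T) = gamma t) /\
    forall S, 0 < S -> (forall t, gamma (t + S) = gamma t) -> T <= S.

Definition TC (F : vector_field) : Prop :=
  smooth_vector_field F /\
  (forall p, circle p -> fst p * fst (F p) + snd p * snd (F p) = 0) /\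
  (forall p, disk p -> (F p = (0, 0) <-> p = origin)) /\
  (forall p, disk p -> p <> origin -> closed_orbit F p).

Definition PTC (F : vector_field) : Prop :=
  TC F /\
  exists theta : R * R -> R,
    smooth theta /\
    forall p, disk p -> p <> origin -> is_period F p (theta p).

Definition parameter_rigid (F : vector_field) : Prop :=
  forall F' : vector_field,
    smooth_vector_field F' ->
    (forall p, disk p ->
       exists q, disk q /\ forall z, orbit F' p z -> orbit F q z) ->
    exists nu : R * R -> R,
      smooth nu /\ forall p, disk p -> F' p = scal (nu p) (F p).

(* Main.v *)
Require Import Defs.
From Stdlib Require Import ZArith Reals Lra Lia Classical ClassicalEpsilon.
From Coquelicot Require Import Coquelicot.
Open Scope R_scope.

(** Away from [O] the field [F] has no zero, and [F'] is parallel to [F]: an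
    [F']-orbit through [p] runs inside the periodic [F]-orbit of [p], whose points
    near [p] are the [gamma(tau)] with [tau] near a multiple of the minimal period.
    So [nu = <F', F> / |F|^2] there, and only smoothness at [O] is at stake.

    The linear part [A] of [F] at [O] is invertible. Otherwise [A^2 = tr(A) A], so
    there are [z] arbitrarily close to [O] at which [F(z)] is an almost eigenvector
    of [A]. The velocity [G] along the orbit of [z] satisfies [G' = DF G] with [DF]
    close to [A], hence keeps a positive component along [G(0)] during any bounded
    time; this contradicts periodicity, as the periods are bounded near [O].

    By Hadamard's lemma [F(z) = A(z) z] with [A] smooth and invertible near [O].
    The field [(u, v) = A(z)^-1 F'(z)] is parallel to [z = (x, y)], so [u] vanishes
    on [x = 0] and [u = nu x] with [nu] smooth; then [v = nu y] and [F' = nu F]. *)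

(** * Smooth functions on open subsets of the plane *)

(** At O the quotient is of type 0/0, and closed orbits alone do not save it: for F = (x^2 +
    y^2)(-y, x) and F' = (-y, x) the orbits coincide, yet nu = 1/(x^2 + y^2). There the periods 2 pi
    / r^2 blow up; the smooth extension of theta excludes this by giving a bound M on the periods
    near O. The identity A^2 = tr(A) A is Cayley-Hamilton with det A = 0, so the eigenvalue in play
    is m = tr A, possibly 0. The order of choices is: M, then a tolerance exponentially small in M,
    then a starting point exponentially close to O, so that a whole period is spent where DF is that
    close to A. Inclusion of orbits says nothing about how a curve of F' runs along an orbit of F.
    Parallelism is therefore read off from difference quotients at common points; minimality of the
    period guarantees that points of the orbit near p have times near 0. Moreover F' need not be
    tangent to the boundary, so from a boundary point it may have no curve inside the disk:
    parallelism is proved in the open disk and carried to the circle by a Lipschitz estimate. *)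

Definition open_2d (U : R -> R -> Prop) : Prop :=
  forall x y, U x y -> locally_2d U x y.

Definition smooth_on (U : R -> R -> Prop) (f : R -> R -> R) : Prop :=
  forall x y, U x y -> forall n, ex_diff_n f n x y.

Definition pderive_x (f : R -> R -> R) (x y : R) : R :=
  Derive (fun z => f z y) x.

Definition pderive_y (f : R -> R -> R) (x y : R) : R :=
  Derive (fun z => f x z) y.

Lemma ex_diff_n_const (c : R) (n : nat) (x y : R) :
  ex_diff_n (fun _ _ => c) n x y.
Proof.
  revert c x y; induction n as [|n IH]; intros c x y; simpl.
  - split; [apply continuity_2d_pt_const | exact I].
  - split; [apply continuity_2d_pt_const |].
    split; [apply ex_derive_const |].
    split; [apply ex_derive_const |].
    split; apply ex_diff_n_ext_loc with (f := fun _ _ => 0); try apply IH;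
      exists (mkposreal 1 Rlt_0_1); intros; now rewrite Derive_const.
Qed.

Lemma ex_diff_n_continuity (f : R -> R -> R) (n : nat) (x y : R) :
  ex_diff_n f n x y -> continuity_2d_pt f x y.
Proof. destruct n; intros H; apply H. Qed.

Lemma ex_diff_n_ext_on (U : R -> R -> Prop) (f g : R -> R -> R) (n : nat) (x y : R) :
  open_2d U -> (forall u v, U u v -> f u v = g u v) -> U x y ->
  ex_diff_n f n x y -> ex_diff_n g n x y.
Proof.
  intros HU H Hxy. apply ex_diff_n_ext_loc.
  destruct (HU x y Hxy) as [d Hd]; exists d; intros; apply H; now apply Hd.
Qed.

(** The hypotheses bear on an open set, not on one point: the formula for the partial derivatives
    must hold in a neighbourhood before it can be differentiated again. The induction on [n] is
    applied to the partial derivatives, hence the generalisation over [f] and [g]. *)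
Lemma ex_diff_n_plus_on (U : R -> R -> Prop) (n : nat) (f g : R -> R -> R) :
  open_2d U ->
  (forall x y, U x y -> ex_diff_n f n x y) ->
  (forall x y, U x y -> ex_diff_n g n x y) ->
  forall x y, U x y -> ex_diff_n (fun u v => f u v + g u v) n x y.
Proof.
  intros HU; revert f g; induction n as [|n IH]; intros f g Hf Hg x y Hxy.
  - split; [| exact I].
    apply continuity_2d_pt_plus; eapply ex_diff_n_continuity; [now apply Hf | now apply Hg].
  - split; [apply continuity_2d_pt_plus; eapply ex_diff_n_continuity;
      [now apply Hf | now apply Hg] |].
    split; [apply (ex_derive_plus (V := R_NormedModule)); [now apply (Hf x y) | now apply (Hg x y)] |].
    split; [apply (ex_derive_plus (V := R_NormedModule)); [now apply (Hf x y) | now apply (Hg x y)] |].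
    split.
    + eapply (ex_diff_n_ext_on U) with (f := fun u v => pderive_x f u v + pderive_x g u v);
        [exact HU | | exact Hxy |].
      * intros u v Huv. unfold pderive_x. rewrite Derive_plus; [easy | |];
          [now apply (Hf u v) | now apply (Hg u v)].
      * apply IH; [| | exact Hxy]; intros u v Huv; [now apply (Hf u v) | now apply (Hg u v)].
    + eapply (ex_diff_n_ext_on U) with (f := fun u v => pderive_y f u v + pderive_y g u v);
        [exact HU | | exact Hxy |].
      * intros u v Huv. unfold pderive_y. rewrite Derive_plus; [easy | |];
          [now apply (Hf u v) | now apply (Hg u v)].
      * apply IH; [| | exact Hxy]; intros u v Huv; [now apply (Hf u v) | now apply (Hg u v)].
Qed.

Lemma ex_diff_n_mult_on (U : R -> R -> Prop) (n : nat) (f g : R -> R -> R) :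
  open_2d U ->
  (forall x y, U x y -> ex_diff_n f n x y) ->
  (forall x y, U x y -> ex_diff_n g n x y) ->
  forall x y, U x y -> ex_diff_n (fun u v => f u v * g u v) n x y.
Proof.
  intros HU; revert f g; induction n as [|n IH]; intros f g Hf Hg x y Hxy.
  - split; [| exact I].
    apply continuity_2d_pt_mult; eapply ex_diff_n_continuity; [now apply Hf | now apply Hg].
  (* The Leibniz rule pairs each derivative with the other function itself, so order [n] is also
     required of [f] and [g], not only of their derivatives. *)
  - assert (Hf' : forall x y, U x y -> ex_diff_n f n x y)
      by (intros; apply ex_diff_n_m with (S n); [lia | now apply Hf]).
    assert (Hg' : forall x y, U x y -> ex_diff_n g n x y)
      by (intros; apply ex_diff_n_m with (S n); [lia | now apply Hg]).
    split; [apply continuity_2d_pt_mult; eapply ex_diff_n_continuity;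
      [now apply Hf | now apply Hg] |].
    split; [apply ex_derive_mult; [now apply (Hf x y) | now apply (Hg x y)] |].
    split; [apply ex_derive_mult; [now apply (Hf x y) | now apply (Hg x y)] |].
    split.
    + eapply (ex_diff_n_ext_on U)
        with (f := fun u v => pderive_x f u v * g u v + f u v * pderive_x g u v);
        [exact HU | | exact Hxy |].
      * intros u v Huv. unfold pderive_x. rewrite Derive_mult; [easy | |];
          [now apply (Hf u v) | now apply (Hg u v)].
      * apply (ex_diff_n_plus_on U); [exact HU | | | exact Hxy]; apply IH; trivial;
          intros u v Huv; [now apply (Hf u v) | now apply (Hg u v)].
    + eapply (ex_diff_n_ext_on U)
        with (f := fun u v => pderive_y f u v * g u v + f u v * pderive_y g u v);
        [exact HU | | exact Hxy |].
      * intros u v Huv. unfold pderive_y. rewrite Derive_mult; [easy | |];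
          [now apply (Hf u v) | now apply (Hg u v)].
      * apply (ex_diff_n_plus_on U); [exact HU | | | exact Hxy]; apply IH; trivial;
          intros u v Huv; [now apply (Hf u v) | now apply (Hg u v)].
Qed.

Lemma smooth_on_const (U : R -> R -> Prop) (c : R) : smooth_on U (fun _ _ => c).
Proof. intros x y _ n; apply ex_diff_n_const. Qed.

Lemma smooth_on_plus (U : R -> R -> Prop) (f g : R -> R -> R) :
  open_2d U -> smooth_on U f -> smooth_on U g -> smooth_on U (fun u v => f u v + g u v).
Proof.
  intros HU Hf Hg x y Hxy n.
  apply (ex_diff_n_plus_on U); trivial; intros; [now apply Hf | now apply Hg].
Qed.

Lemma smooth_on_mult (U : R -> R -> Prop) (f g : R -> R -> R) :
  open_2d U -> smooth_on U f -> smooth_on U g -> smooth_on U (fun u v => f u v * g u v).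
Proof.
  intros HU Hf Hg x y Hxy n.
  apply (ex_diff_n_mult_on U); trivial; intros; [now apply Hf | now apply Hg].
Qed.

Lemma smooth_on_ext (U : R -> R -> Prop) (f g : R -> R -> R) :
  open_2d U -> (forall u v, U u v -> f u v = g u v) -> smooth_on U f -> smooth_on U g.
Proof. intros HU H Hf x y Hxy n. apply (ex_diff_n_ext_on U f); trivial; now apply Hf. Qed.

Lemma smooth_on_minus (U : R -> R -> Prop) (f g : R -> R -> R) :
  open_2d U -> smooth_on U f -> smooth_on U g -> smooth_on U (fun u v => f u v - g u v).
Proof.
  intros HU Hf Hg.
  apply (smooth_on_ext U (fun u v => f u v + (-1) * g u v)); [exact HU | intros; ring |].
  apply smooth_on_plus; trivial. apply smooth_on_mult; trivial. apply smooth_on_const.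
Qed.

Lemma smooth_on_pderive_x (U : R -> R -> Prop) (f : R -> R -> R) :
  smooth_on U f -> smooth_on U (pderive_x f).
Proof. intros Hf x y Hxy n. now apply (Hf x y Hxy (S n)). Qed.

Lemma smooth_on_pderive_y (U : R -> R -> Prop) (f : R -> R -> R) :
  smooth_on U f -> smooth_on U (pderive_y f).
Proof. intros Hf x y Hxy n. now apply (Hf x y Hxy (S n)). Qed.

Lemma smooth_on_is_derive_x (U : R -> R -> Prop) (f : R -> R -> R) (x y : R) :
  smooth_on U f -> U x y -> is_derive (fun z => f z y) x (pderive_x f x y).
Proof. intros Hf Hxy. apply Derive_correct. now apply (Hf x y Hxy 1%nat). Qed.

Lemma smooth_on_is_derive_y (U : R -> R -> Prop) (f : R -> R -> R) (x y : R) :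
  smooth_on U f -> U x y -> is_derive (fun z => f x z) y (pderive_y f x y).
Proof. intros Hf Hxy. apply Derive_correct. now apply (Hf x y Hxy 1%nat). Qed.

Lemma smooth_on_continuity (U : R -> R -> Prop) (f : R -> R -> R) (x y : R) :
  smooth_on U f -> U x y -> continuity_2d_pt f x y.
Proof. intros Hf Hxy. exact (ex_diff_n_continuity f 0 x y (Hf x y Hxy 0%nat)). Qed.

Lemma smooth_on_subset (U V : R -> R -> Prop) (f : R -> R -> R) :
  (forall x y, V x y -> U x y) -> smooth_on U f -> smooth_on V f.
Proof. intros H Hf x y Hxy. apply Hf. now apply H. Qed.

(** The derivative of 1/f is -f' (1/f)(1/f): order n + 1 of 1/f reduces to order n of 1/f, which is
    the induction hypothesis. *)
Lemma smooth_on_inv (U : R -> R -> Prop) (f : R -> R -> R) :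
  open_2d U -> smooth_on U f -> (forall x y, U x y -> f x y <> 0) ->
  smooth_on U (fun u v => / f u v).
Proof.
  intros HU Hf Hnz.
  enough (H : forall n x y, U x y -> ex_diff_n (fun u v => / f u v) n x y)
    by (intros x y Hxy n; now apply H).
  induction n as [|n IH]; intros x y Hxy.
  - split; [| exact I].
    apply continuity_2d_pt_inv; [now apply (smooth_on_continuity U) | now apply Hnz].
  - assert (Hc : forall h, smooth_on U h -> forall u v, U u v ->
      ex_diff_n (fun u v => (-1) * h u v * (/ f u v * / f u v)) n u v).
    { intros h Hh. apply ex_diff_n_mult_on; trivial.
      - apply ex_diff_n_mult_on; trivial; intros; [apply ex_diff_n_const | now apply Hh].
      - apply ex_diff_n_mult_on; trivial. }
    split; [apply continuity_2d_pt_inv; [now apply (smooth_on_continuity U) | now apply Hnz] |].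
    split; [apply ex_derive_inv; [now apply (Hf x y Hxy 1%nat) | now apply Hnz] |].
    split; [apply ex_derive_inv; [now apply (Hf x y Hxy 1%nat) | now apply Hnz] |].
    split.
    + eapply (ex_diff_n_ext_on U); [exact HU | | exact Hxy |
        apply (Hc (pderive_x f)); [now apply smooth_on_pderive_x | exact Hxy]].
      intros u v Huv. cbv beta. unfold pderive_x. rewrite Derive_inv;
        [| now apply (Hf u v Huv 1%nat) | now apply Hnz].
      field. now apply Hnz.
    + eapply (ex_diff_n_ext_on U); [exact HU | | exact Hxy |
        apply (Hc (pderive_y f)); [now apply smooth_on_pderive_y | exact Hxy]].
      intros u v Huv. cbv beta. unfold pderive_y. rewrite Derive_inv;
        [| now apply (Hf u v Huv 1%nat) | now apply Hnz].
      change (Derive (fun z => f u z) v) with (Derive (f u) v). field. now apply Hnz.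
Qed.

(** * Hadamard's lemma *)

(** Squares are the neighbourhoods used by [locally_2d], and they are stable under the exchange of
    coordinates and under contracting each coordinate separately. *)
Definition square (r x y : R) : Prop := Rabs x < r /\ Rabs y < r.

Lemma Rabs_lt_shift (z x d : R) : Rabs (z - x) < d -> Rabs z < d + Rabs x.
Proof.
  intros H. assert (K := Rabs_triang (z - x) x).
  replace (z - x + x) with z in K by ring. lra.
Qed.

Lemma open_square (r : R) : open_2d (square r).
Proof.
  intros x y [Hx Hy].
  assert (Hd : 0 < Rmin (r - Rabs x) (r - Rabs y)) by (apply Rmin_case; lra).
  exists (mkposreal _ Hd). simpl. intros u v Hu Hv.
  assert (H1 := Rmin_l (r - Rabs x) (r - Rabs y)).
  assert (H2 := Rmin_r (r - Rabs x) (r - Rabs y)).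
  apply Rabs_lt_shift in Hu, Hv.
  split; lra.
Qed.

Lemma continuity_2d_pt_comp (h p q : R -> R -> R) (x y : R) :
  continuity_2d_pt h (p x y) (q x y) ->
  continuity_2d_pt p x y -> continuity_2d_pt q x y ->
  continuity_2d_pt (fun u v => h (p u v) (q u v)) x y.
Proof.
  intros Hh Hp Hq eps.
  destruct (Hh eps) as [d Hd].
  destruct (Hp d) as [d1 H1]. destruct (Hq d) as [d2 H2].
  assert (Hm : 0 < Rmin d1 d2) by (apply Rmin_case; apply cond_pos).
  exists (mkposreal _ Hm). simpl. intros u v Hu Hv.
  assert (Ha := Rmin_l d1 d2). assert (Hb := Rmin_r d1 d2).
  apply Hd; [apply H1 | apply H2]; lra.
Qed.

Lemma continuity_2d_pt_snd (w : R -> R) (x y : R) :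
  continuity_pt w y -> continuity_2d_pt (fun _ v => w v) x y.
Proof.
  intros H. apply (continuity_1d_2d_pt_comp w (fun _ v => v)); [exact H |].
  apply continuity_2d_pt_id2.
Qed.

Lemma continuity_2d_pt_slice_x (h : R -> R -> R) (x y : R) :
  continuity_2d_pt h x y -> continuous (fun u => h u y) x.
Proof.
  intros H P [e He]. destruct (H e) as [d Hd].
  exists d. intros u Hu. apply He. apply Hd; [exact Hu |].
  rewrite Rminus_diag, Rabs_R0. apply cond_pos.
Qed.

Lemma continuity_2d_pt_slice_y (h : R -> R -> R) (x y : R) :
  continuity_2d_pt h x y -> continuous (fun v => h x v) y.
Proof.
  intros H P [e He]. destruct (H e) as [d Hd].
  exists d. intros u Hu. apply He. apply Hd; [| exact Hu].
  rewrite Rminus_diag, Rabs_R0. apply cond_pos.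
Qed.

(** Covers the three factors t, 1 and 0 that Hadamard's lemma requires; the bound on [0, 1] keeps
    the dilated points inside the square. *)
Definition dilation (a : R -> R) : Prop :=
  (forall t, continuity_pt a t) /\ forall t, 0 <= t <= 1 -> Rabs (a t) <= 1.

(** The weight [w] makes the family stable under differentiation: a partial derivative of an average
    is the average of a partial derivative of [h], with weight [w] times [a] or [b]. *)
Definition average (w a b : R -> R) (h : R -> R -> R) (x y : R) : R :=
  RInt (fun t => w t * h (a t * x) (b t * y)) 0 1.

Section Average.

Variables (r : R) (a b : R -> R).
Hypotheses (Ha : dilation a) (Hb : dilation b).

Lemma dilation_lt (c : R -> R) (t x s : R) :
  dilation c -> 0 <= t <= 1 -> Rabs x < s -> Rabs (c t * x) < s.
Proof.
  intros [_ Hc] Ht Hx. rewrite Rabs_mult.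
  assert (H1 := Hc t Ht). assert (H2 := Rabs_pos x). assert (H3 := Rabs_pos (c t)). nra.
Qed.

Lemma average_integrand_continuity (w : R -> R) (h : R -> R -> R) (x y t : R) :
  continuity_pt w t -> smooth_on (square r) h -> square r x y -> 0 <= t <= 1 ->
  continuity_2d_pt (fun u v => w v * h (a v * u) (b v * y)) x t.
Proof.
  intros Hw Hh [Hx Hy] Ht.
  apply continuity_2d_pt_mult; [now apply continuity_2d_pt_snd |].
  apply (continuity_2d_pt_comp h (fun u v => a v * u) (fun u v => b v * y)).
  - apply (smooth_on_continuity (square r)); [exact Hh |].
    split; now apply dilation_lt.
  - apply continuity_2d_pt_mult; [apply continuity_2d_pt_snd, Ha | apply continuity_2d_pt_id1].
  - apply continuity_2d_pt_mult; [apply continuity_2d_pt_snd, Hb | apply continuity_2d_pt_const].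
Qed.

Lemma average_ex_RInt (w : R -> R) (h : R -> R -> R) (x y : R) :
  (forall t, continuity_pt w t) -> smooth_on (square r) h -> square r x y ->
  ex_RInt (fun t => w t * h (a t * x) (b t * y)) 0 1.
Proof.
  intros Hw Hh Hxy. apply (ex_RInt_continuous (V := R_CompleteNormedModule)).
  rewrite Rmin_left, Rmax_right by lra. intros t Ht.
  apply (continuity_2d_pt_slice_y (fun u v => w v * h (a v * u) (b v * y))).
  now apply average_integrand_continuity.
Qed.

Lemma average_continuity (w : R -> R) (h : R -> R -> R) (x y : R) :
  (forall t, continuity_pt w t) -> smooth_on (square r) h -> square r x y ->
  continuity_2d_pt (average w a b h) x y.
Proof.
  intros Hw Hh Hxy eps. destruct Hxy as [Hx Hy].
  set (m := Rmax (Rabs x) (Rabs y)).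
  assert (Hmr : m < r) by (unfold m; apply Rmax_case; lra).
  assert (Hmx : Rabs x <= m) by apply Rmax_l.
  assert (Hmy : Rabs y <= m) by apply Rmax_r.
  (* A half-side strictly between that of (x, y) and [r]: the closed square is compact in the
     domain, so [h] is uniformly continuous on it, and it contains all dilates of points close to
     (x, y). *)
  set (s := (m + r) / 2).
  destruct (continuity_ab_maj (fun t => Rabs (w t)) 0 1) as [tm [Hmax _]]; [lra | |].
  { intros c _. apply (continuity_pt_comp w Rabs); [apply Hw | apply Rcontinuity_abs]. }
  (* The added 1 keeps the bound positive when the weight vanishes. *)
  set (W := Rabs (w tm) + 1).
  assert (HW : 0 < W) by (unfold W; assert (K := Rabs_pos (w tm)); lra).
  assert (He : 0 < eps / (2 * W)) by (apply Rdiv_lt_0_compat; [apply cond_pos | lra]).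
  destruct (uniform_continuity_2d h (- s) s (- s) s) with (eps := mkposreal _ He)
    as [d Hd].
  { intros u v Hu Hv. apply (smooth_on_continuity (square r)); [exact Hh |].
    split; apply Rabs_def1; unfold s in *; lra. }
  assert (Hdd : 0 < Rmin d (s - m)) by (apply Rmin_case; [apply cond_pos | unfold s; lra]).
  exists (mkposreal _ Hdd). simpl. intros u v Hu Hv.
  assert (K1 := Rmin_l d (s - m)). assert (K2 := Rmin_r d (s - m)).
  assert (Hus : Rabs u < s).
  { apply Rabs_lt_shift in Hu. lra. }
  assert (Hvs : Rabs v < s).
  { apply Rabs_lt_shift in Hv. lra. }
  assert (Hsr : s < r) by (unfold s; lra).
  unfold average.
  assert (E1 := average_ex_RInt w h u v Hw Hh (conj (Rlt_trans _ _ _ Hus Hsr) (Rlt_trans _ _ _ Hvs Hsr))).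
  assert (E2 := average_ex_RInt w h x y Hw Hh (conj Hx Hy)).
  assert (EM := RInt_minus (V := R_CompleteNormedModule) _ _ 0 1 E1 E2).
  unfold minus, plus, opp in EM; simpl in EM. unfold Rminus. rewrite <- EM.
  apply Rle_lt_trans with ((1 - 0) * (eps / 2));
    [| assert (K := cond_pos eps); lra].
  apply abs_RInt_le_const; [lra | |].
  - apply (ex_RInt_minus (V := R_NormedModule)); assumption.
  - intros t Ht.
    replace (w t * h (a t * u) (b t * v) + - (w t * h (a t * x) (b t * y)))
      with (w t * (h (a t * u) (b t * v) - h (a t * x) (b t * y))) by ring.
    rewrite Rabs_mult.
    assert (Hin : forall c z, dilation c -> Rabs z < s -> - s <= c t * z <= s).
    { intros c z Hc Hz. assert (K := dilation_lt c t z s Hc Ht Hz).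
      apply Rabs_def2 in K. lra. }
    assert (Hcl : forall c z z', dilation c -> Rabs (z - z') < d ->
      Rabs (c t * z - c t * z') < d).
    { intros c z z' Hc Hz. rewrite <- Rmult_minus_distr_l. now apply dilation_lt. }
    assert (K : Rabs (h (a t * u) (b t * v) - h (a t * x) (b t * y)) < eps / (2 * W)).
    { apply Hd; try (apply Hin; trivial; unfold s in *; lra); apply Hcl; trivial; lra. }
    assert (Kw : Rabs (w t) <= W) by (specialize (Hmax t Ht); unfold W; lra).
    assert (K3 := Rabs_pos (w t)).
    assert (K4 := Rabs_pos (h (a t * u) (b t * v) - h (a t * x) (b t * y))).
    apply Rle_trans with (W * (eps / (2 * W))).
    + apply Rmult_le_compat; lra.
    + apply Req_le. field. lra.
Qed.

Lemma average_is_derive_x (w : R -> R) (h : R -> R -> R) (x y : R) :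
  (forall t, continuity_pt w t) -> smooth_on (square r) h -> square r x y ->
  is_derive (fun z => average w a b h z y) x
    (average (fun t => w t * a t) a b (pderive_x h) x y).
Proof.
  intros Hw Hh [Hx Hy].
  assert (HD : forall t u, Rabs (a t * u) < r -> Rabs (b t * y) < r ->
    is_derive (fun z => w t * h (a t * z) (b t * y)) u
      (w t * (a t * pderive_x h (a t * u) (b t * y)))).
  { intros t u H1 H2. apply is_derive_scal.
    apply (is_derive_comp (fun z => h z (b t * y)) (fun z => a t * z)).
    - apply (smooth_on_is_derive_x (square r)); [exact Hh | now split].
    - auto_derive; [trivial | ring]. }
  unfold average.
  replace (RInt (fun t => w t * a t * pderive_x h (a t * x) (b t * y)) 0 1)
    with (RInt (fun t => Derive (fun u => w t * h (a t * u) (b t * y)) x) 0 1).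
  2: { apply RInt_ext. rewrite Rmin_left, Rmax_right by lra. intros t Ht.
    etransitivity; [apply is_derive_unique, HD; apply dilation_lt; trivial; lra |].
    match goal with |- @eq _ ?l ?k => change (@eq R l k) end. ring. }
  assert (Hloc : locally x (fun z => Rabs z < r)).
  { assert (Hp : 0 < r - Rabs x) by lra. exists (mkposreal _ Hp). intros z Hz.
    apply (Rabs_lt_shift z x) in Hz. simpl in Hz. lra. }
  apply (is_derive_RInt_param (fun u t => w t * h (a t * u) (b t * y))).
  - revert Hloc; apply filter_imp. intros z Hz t Ht.
    rewrite Rmin_left, Rmax_right in Ht by lra.
    eexists. apply (HD t z); now apply dilation_lt.
  - intros t Ht. rewrite Rmin_left, Rmax_right in Ht by lra.
    apply continuity_2d_pt_ext_loc
      with (f := fun u v => w v * (a v * pderive_x h (a v * u) (b v * y))).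
    + assert (C1 : continuity_2d_pt (fun u v => a v * u) x t).
      { apply continuity_2d_pt_mult; [apply continuity_2d_pt_snd, Ha | apply continuity_2d_pt_id1]. }
      assert (C2 : continuity_2d_pt (fun u v => b v * y) x t).
      { apply continuity_2d_pt_mult; [apply continuity_2d_pt_snd, Hb | apply continuity_2d_pt_const]. }
      destruct (open_square r (a t * x) (b t * y)) as [d Hd];
        [split; now apply dilation_lt |].
      destruct (C1 d) as [d1 H1]. destruct (C2 d) as [d2 H2].
      assert (Hm : 0 < Rmin d1 d2) by (apply Rmin_case; apply cond_pos).
      exists (mkposreal _ Hm). simpl. intros u v Hu Hv.
      assert (K1 := Rmin_l d1 d2). assert (K2 := Rmin_r d1 d2).
      symmetry. apply is_derive_unique.
      destruct (Hd (a v * u) (b v * y)) as [L1 L2];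
        [apply H1; lra | apply (H2 u v); lra |].
      now apply HD.
    + apply continuity_2d_pt_ext
        with (f := fun u v => (w v * a v) * pderive_x h (a v * u) (b v * y));
        [intros; ring |].
      apply (average_integrand_continuity (fun t => w t * a t)); trivial.
      * apply continuity_pt_mult; [apply Hw | apply Ha].
      * now apply smooth_on_pderive_x.
      * now split.
  - revert Hloc; apply filter_imp. intros z Hz.
    apply average_ex_RInt; trivial. now split.
Qed.

End Average.

Lemma continuity_2d_pt_swap (h : R -> R -> R) (x y : R) :
  continuity_2d_pt h x y -> continuity_2d_pt (fun u v => h v u) y x.
Proof. intros H eps. destruct (H eps) as [d Hd]. exists d; intros; now apply Hd. Qed.

Lemma ex_diff_n_swap (n : nat) (h : R -> R -> R) (x y : R) :
  ex_diff_n h n x y -> ex_diff_n (fun u v => h v u) n y x.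
Proof.
  revert h; induction n as [|n IH]; intros h H.
  - split; [| exact I]. now apply continuity_2d_pt_swap, H.
  - destruct H as (H0 & H1 & H2 & H3 & H4).
    split; [now apply continuity_2d_pt_swap |].
    split; [exact H2 |]. split; [exact H1 |].
    split; [exact (IH _ H4) | exact (IH _ H3)].
Qed.

Lemma smooth_on_swap (r : R) (h : R -> R -> R) :
  smooth_on (square r) h -> smooth_on (square r) (fun u v => h v u).
Proof. intros H x y [Hx Hy] n. apply ex_diff_n_swap. now apply H. Qed.

(** Induction on the order, with [w] and [h] generalised because differentiating changes both. *)
Lemma smooth_on_average (r : R) (w a b : R -> R) (h : R -> R -> R) :
  dilation a -> dilation b -> (forall t, continuity_pt w t) ->
  smooth_on (square r) h -> smooth_on (square r) (average w a b h).
Proof.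
  intros Ha Hb Hw Hh x y Hxy n. revert w h Hw Hh x y Hxy.
  induction n as [|n IH]; intros w h Hw Hh x y Hxy.
  - split; [| exact I]. now apply (average_continuity r).
  (* Exchanging the coordinates exchanges [a] and [b], and turns this into the x-derivative already
     computed. *)
  - assert (Dy : forall u v, square r u v -> is_derive (fun z => average w a b h u z) v
      (average (fun t => w t * b t) a b (pderive_y h) u v)).
    { intros u v [Hu Hv].
      apply (average_is_derive_x r b a Hb Ha w (fun u v => h v u) v u); trivial.
      - now apply smooth_on_swap.
      - now split. }
    split; [now apply (average_continuity r) |].
    split; [eexists; now apply (average_is_derive_x r) |].
    split; [eexists; now apply Dy |].
    split.
    + eapply (ex_diff_n_ext_on (square r)); [apply open_square | | exact Hxy |].
      * intros u v Huv. symmetry. apply is_derive_unique.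
        now apply (average_is_derive_x r a b Ha Hb w h u v).
      * apply IH; trivial.
        -- intros t; apply continuity_pt_mult; [apply Hw | apply Ha].
        -- now apply smooth_on_pderive_x.
    + eapply (ex_diff_n_ext_on (square r)); [apply open_square | | exact Hxy |].
      * intros u v Huv. symmetry. apply is_derive_unique. now apply Dy.
      * apply IH; trivial.
        -- intros t; apply continuity_pt_mult; [apply Hw | apply Hb].
        -- now apply smooth_on_pderive_y.
Qed.

(** Fundamental theorem of calculus for t -> p(t x) on [0, 1]. *)
Lemma RInt_dilated_derivative (p p' : R -> R) (r x : R) :
  (forall z, Rabs z < r -> is_derive p z (p' z)) ->
  (forall z, Rabs z < r -> continuous p' z) ->
  Rabs x < r -> p x - p 0 = x * RInt (fun t => p' (t * x)) 0 1.
Proof.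
  intros Hp Hc Hx.
  assert (Hin : forall t, 0 <= t <= 1 -> Rabs (t * x) < r).
  { intros t Ht. rewrite Rabs_mult, (Rabs_pos_eq t) by lra.
    assert (K := Rabs_pos x). nra. }
  assert (H : is_RInt (fun t => x * p' (t * x)) 0 1 (minus (p (1 * x)) (p (0 * x)))).
  { apply (is_RInt_derive (fun t => p (t * x)));
      rewrite Rmin_left, Rmax_right by lra; intros t Ht.
    - apply (is_derive_comp p (fun t => t * x)); [now apply Hp, Hin |].
      auto_derive; [trivial | ring].
    - apply (continuous_mult (fun _ => x)); [apply continuous_const |].
      apply continuous_comp; [| now apply Hc, Hin].
      apply (continuous_mult (fun t => t) (fun _ => x));
        [apply continuous_id | apply continuous_const]. }
  apply (is_RInt_unique (V := R_CompleteNormedModule)) in H.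
  rewrite Rmult_1_l, Rmult_0_l in H. unfold minus, plus, opp in H; simpl in H.
  unfold Rminus. rewrite <- H.
  apply (RInt_scal (V := R_CompleteNormedModule)).
  apply (ex_RInt_continuous (V := R_CompleteNormedModule)).
  rewrite Rmin_left, Rmax_right by lra. intros t Ht.
  apply (continuous_comp (fun t => t * x) p'); [| now apply Hc, Hin].
  apply (continuous_mult (fun t => t) (fun _ => x));
    [apply continuous_id | apply continuous_const].
Qed.

Lemma dilation_id : dilation (fun t => t).
Proof.
  split; [intros t; apply derivable_continuous_pt, derivable_pt_id |].
  intros t Ht. rewrite Rabs_pos_eq; lra.
Qed.

Lemma dilation_const (c : R) : Rabs c <= 1 -> dilation (fun _ => c).
Proof. intros Hc. split; [intros t; now apply continuity_pt_const | now intros]. Qed.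

Lemma hadamard_x (r : R) (h : R -> R -> R) :
  smooth_on (square r) h ->
  exists k, smooth_on (square r) k /\
    forall x y, square r x y -> h x y = h 0 y + x * k x y.
Proof.
  intros Hh. exists (average (fun _ => 1) (fun t => t) (fun _ => 1) (pderive_x h)).
  split.
  - apply smooth_on_average; [apply dilation_id | apply dilation_const | |].
    + rewrite Rabs_R1; lra.
    + intros; now apply continuity_pt_const.
    + now apply smooth_on_pderive_x.
  - intros x y [Hx Hy]. unfold average.
    rewrite (RInt_ext _ (fun t => pderive_x h (t * x) y)).
    2: { intros t _. now rewrite !Rmult_1_l. }
    rewrite <- (RInt_dilated_derivative (fun z => h z y) (fun z => pderive_x h z y) r);
      [ring | | | exact Hx].
    + intros z Hz. apply (smooth_on_is_derive_x (square r)); [exact Hh | now split].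
    + intros z Hz. apply (continuity_2d_pt_slice_x (pderive_x h)).
      apply (smooth_on_continuity (square r)); [now apply smooth_on_pderive_x | now split].
Qed.

(** Complements [hadamard_x], which leaves the restriction of [h] to the axis x = 0. Dilating the
    first variable by 0 gives a quotient that depends on y alone, presented as a function of two
    variables. *)
Lemma hadamard_y (r : R) (h : R -> R -> R) :
  smooth_on (square r) h ->
  exists k, smooth_on (square r) k /\
    forall x y, square r x y -> h 0 y = h 0 0 + y * k x y.
Proof.
  intros Hh. exists (average (fun _ => 1) (fun _ => 0) (fun t => t) (pderive_y h)).
  split.
  - apply smooth_on_average; [apply dilation_const | apply dilation_id | |].
    + rewrite Rabs_R0; lra.
    + intros; now apply continuity_pt_const.
    + now apply smooth_on_pderive_y.
  - intros x y [Hx Hy]. unfold average.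
    assert (H0 : Rabs 0 < r) by (rewrite Rabs_R0; assert (K := Rabs_pos x); lra).
    rewrite (RInt_ext _ (fun t => pderive_y h 0 (t * y))).
    2: { intros t _. now rewrite Rmult_1_l, Rmult_0_l. }
    rewrite <- (RInt_dilated_derivative (fun z => h 0 z) (fun z => pderive_y h 0 z) r);
      [ring | | | exact Hy].
    + intros z Hz. apply (smooth_on_is_derive_y (square r)); [exact Hh | now split].
    + intros z Hz. apply (continuity_2d_pt_slice_y (pderive_y h)).
      apply (smooth_on_continuity (square r)); [now apply smooth_on_pderive_y | now split].
Qed.

Lemma hadamard (r : R) (h : R -> R -> R) :
  smooth_on (square r) h -> h 0 0 = 0 ->
  exists k l, smooth_on (square r) k /\ smooth_on (square r) l /\
    forall x y, square r x y -> h x y = k x y * x + l x y * y.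
Proof.
  intros Hh H0. destruct (hadamard_x r h Hh) as (k & Hk & Ek).
  destruct (hadamard_y r h Hh) as (l & Hl & El).
  exists k, l. split; [exact Hk |]. split; [exact Hl |].
  intros x y Hxy. rewrite (Ek x y Hxy), (El x y Hxy), H0. ring.
Qed.

(** * Lipschitz bounds on the disk *)

Lemma is_derive_continuity_pt (f : R -> R) (x l : R) :
  is_derive f x l -> continuity_pt f x.
Proof.
  intros H. apply continuity_pt_filterlim.
  apply (ex_derive_continuous (V := R_NormedModule)). now exists l.
Qed.

Lemma lipschitz_of_bounded_derivative (p p' : R -> R) (c d K s t : R) :
  (forall z, Rabs (z - c) < d -> is_derive p z (p' z)) ->
  (forall z, Rabs (z - c) < d -> Rabs (p' z) <= K) ->
  Rabs (s - c) < d -> Rabs (t - c) < d ->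
  Rabs (p s - p t) <= K * Rabs (s - t).
Proof.
  intros Hp HK Hs Ht.
  assert (Hin : forall z, Rmin t s <= z <= Rmax t s -> Rabs (z - c) < d).
  { intros z Hz. apply Rabs_def2 in Hs, Ht. apply Rabs_def1.
    - assert (Rmax t s < c + d) by (apply Rmax_case; lra). lra.
    - assert (c - d < Rmin t s) by (apply Rmin_case; lra). lra. }
  destruct (MVT_gen p t s p') as (z & Hz & E).
  - intros z Hz. apply Hp, Hin; lra.
  - intros z Hz. eapply is_derive_continuity_pt, Hp, Hin, Hz.
  - rewrite E, Rabs_mult. apply Rmult_le_compat_r; [apply Rabs_pos | now apply HK, Hin].
Qed.

(** Mean value theorem along the two sides of a corner path. In the constant [K], the 1 is the
    allowed variation of each partial derivative around its value at the centre. *)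
Lemma ex_diff_n_locally_lipschitz (g : R -> R -> R) (x y : R) :
  locally_2d (fun u v => ex_diff_n g 1 u v) x y ->
  exists d K, 0 < d /\ 0 < K /\
    forall u v u' v', Rabs (u - x) < d -> Rabs (v - y) < d ->
      Rabs (u' - x) < d -> Rabs (v' - y) < d ->
      Rabs (g u v - g u' v') <= K * (Rabs (u - u') + Rabs (v - v')).
Proof.
  intros [d0 H0].
  assert (Hxy : ex_diff_n g 1 x y).
  { apply H0; rewrite Rminus_diag, Rabs_R0; apply cond_pos. }
  destruct Hxy as (_ & _ & _ & [Cx _] & [Cy _]).
  destruct (Cx (mkposreal 1 Rlt_0_1)) as [d1 H1].
  destruct (Cy (mkposreal 1 Rlt_0_1)) as [d2 H2].
  simpl in H1, H2.
  set (d := Rmin d0 (Rmin d1 d2)).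
  assert (Hd : 0 < d) by (repeat apply Rmin_case; apply cond_pos).
  assert (Hd0 : d <= d0) by apply Rmin_l.
  assert (Hd1 : d <= d1) by (eapply Rle_trans; [apply Rmin_r | apply Rmin_l]).
  assert (Hd2 : d <= d2) by (eapply Rle_trans; [apply Rmin_r | apply Rmin_r]).
  set (K := Rabs (pderive_x g x y) + Rabs (pderive_y g x y) + 1).
  assert (Kx := Rabs_pos (pderive_x g x y)). assert (Ky := Rabs_pos (pderive_y g x y)).
  exists d, K. split; [exact Hd |]. split; [unfold K; lra |].
  intros u v u' v' Hu Hv Hu' Hv'.
  replace (g u v - g u' v') with ((g u v - g u' v) + (g u' v - g u' v')) by ring.
  eapply Rle_trans; [apply Rabs_triang |]. rewrite Rmult_plus_distr_l.
  apply Rplus_le_compat.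
  - apply (lipschitz_of_bounded_derivative (fun z => g z v) (fun z => pderive_x g z v) x d);
      trivial; intros z Hz.
    + apply Derive_correct. now apply (H0 z v); lra.
    + assert (B : Rabs (pderive_x g z v - pderive_x g x y) < 1) by (apply (H1 z v); lra).
      apply Rabs_lt_shift in B. unfold K. lra.
  - apply (lipschitz_of_bounded_derivative (fun z => g u' z) (fun z => pderive_y g u' z) y d);
      trivial; intros z Hz.
    + apply Derive_correct. now apply (H0 u' z); lra.
    + assert (B : Rabs (pderive_y g u' z - pderive_y g x y) < 1) by (apply (H2 u' z); lra).
      apply Rabs_lt_shift in B. unfold K. lra.
Qed.

Definition dist1 (p q : R * R) : R := Rabs (fst p - fst q) + Rabs (snd p - snd q).

Lemma dist1_pos (p q : R * R) : 0 <= dist1 p q.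
Proof.
  unfold dist1. assert (H := Rabs_pos (fst p - fst q)).
  assert (K := Rabs_pos (snd p - snd q)). lra.
Qed.

Definition near (d : R) (c p : R * R) : Prop :=
  Rabs (fst p - fst c) < d /\ Rabs (snd p - snd c) < d.

Lemma smooth_extension (f : R * R -> R) (c : R * R) :
  smooth f -> disk c ->
  exists (g : R -> R -> R) (d : R), 0 < d /\
    smooth_on (fun x y => near d c (x, y)) g /\
    forall p, near d c p -> disk p -> f p = g (fst p) (snd p).
Proof.
  intros Hf Hc. destruct (Hf c Hc) as [g [d Hd]].
  exists g, d. split; [apply cond_pos |].
  assert (Hb : forall p, near d c p -> ball c d p) by (intros p Hp; exact Hp).
  split.
  - intros x y Hxy n. now apply (Hd (x, y)), Hb.
  - intros p Hp Dp. now apply Hd, Dp.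
Qed.

Lemma open_near (d : R) (c : R * R) : open_2d (fun x y => near d c (x, y)).
Proof.
  intros x y [Hx Hy]; simpl in Hx, Hy.
  destruct (open_square d (x - fst c) (y - snd c)) as [e He]; [now split |].
  exists e. intros u v Hu Hv.
  apply (He (u - fst c) (v - snd c)).
  - now replace (u - fst c - (x - fst c)) with (u - x) by ring.
  - now replace (v - snd c - (y - snd c)) with (v - y) by ring.
Qed.

Lemma smooth_locally_lipschitz (f : R * R -> R) (c : R * R) :
  smooth f -> disk c ->
  exists d K, 0 < d /\ 0 < K /\
    (forall p, near d c p -> disk p -> Rabs (f p) <= K) /\
    forall p q, near d c p -> near d c q -> disk p -> disk q ->
      Rabs (f p - f q) <= K * dist1 p q.
Proof.
  intros Hf Hc. destruct (smooth_extension f c Hf Hc) as (g & d0 & Hd0 & Hg & E).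
  assert (Nc : forall d, 0 < d -> near d c c)
    by (intros d Hd; split; rewrite Rminus_diag, Rabs_R0; exact Hd).
  destruct (ex_diff_n_locally_lipschitz g (fst c) (snd c)) as (d1 & K & Hd1 & HK & H1).
  { destruct (open_near d0 c (fst c) (snd c)) as [e He];
      [rewrite <- surjective_pairing; now apply Nc |].
    exists e. intros u v Hu Hv. now apply Hg, He. }
  set (d := Rmin d0 (Rmin d1 1)).
  assert (Hd : 0 < d) by (repeat apply Rmin_case; lra).
  assert (L0 : d <= d0) by apply Rmin_l.
  assert (L1 : d <= d1) by (eapply Rle_trans; [apply Rmin_r | apply Rmin_l]).
  assert (L2 : d <= 1) by (eapply Rle_trans; [apply Rmin_r | apply Rmin_r]).
  assert (HL : forall p q, near d c p -> near d c q -> disk p -> disk q ->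
      Rabs (f p - f q) <= K * dist1 p q).
  { intros p q [P1 P2] [Q1 Q2] Dp Dq. rewrite (E p), (E q); trivial; try (split; lra).
    apply H1; lra. }
  assert (F0 := Rabs_pos (f c)).
  (* Points at sup-distance less than [d <= 1] are at [dist1] at most 2 from the centre, so |f| <=
     |f(c)| + 2K there; one number serves as bound and as Lipschitz constant. *)
  exists d, (2 * K + Rabs (f c)). split; [exact Hd |]. split; [lra |]. split.
  - intros p Np Dp. assert (B := HL p c Np (Nc d Hd) Dp Hc).
    destruct Np as [N1 N2].
    assert (B' : Rabs (f p - f c) <= K * 2).
    { eapply Rle_trans; [exact B |]. apply Rmult_le_compat_l; [lra |]. unfold dist1; lra. }
    assert (T := Rabs_triang (f p - f c) (f c)). replace (f p - f c + f c) with (f p) in T by ring.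
    lra.
  - intros p q Np Nq Dp Dq. eapply Rle_trans; [now apply HL |].
    apply Rmult_le_compat_r; [apply dist1_pos | lra].
Qed.

Lemma disk_closed (c : R * R) :
  ~ disk c -> exists d, 0 < d /\ forall p, near d c p -> ~ disk p.
Proof.
  intros Hc. unfold disk in *. apply Rnot_le_lt in Hc.
  assert (C : continuity_2d_pt (fun u v => u * u + v * v) (fst c) (snd c)).
  { apply continuity_2d_pt_plus; apply continuity_2d_pt_mult;
      (apply continuity_2d_pt_id1 || apply continuity_2d_pt_id2). }
  assert (Hp : 0 < fst c ^ 2 + snd c ^ 2 - 1) by lra.
  destruct (C (mkposreal _ Hp)) as [d Hd]. simpl in Hd.
  exists d. split; [apply cond_pos |]. intros p [P1 P2] Dp.
  specialize (Hd (fst p) (snd p) P1 P2). apply Rabs_def2 in Hd. simpl in Hc, Dp, Hd. lra.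
Qed.

Lemma disk_bounds (p : R * R) : disk p -> -1 <= fst p <= 1 /\ -1 <= snd p <= 1.
Proof.
  unfold disk. intros H. assert (H1 := pow2_ge_0 (fst p)). assert (H2 := pow2_ge_0 (snd p)).
  split; split; nra.
Qed.

Definition lipschitz_on_disk (f : R * R -> R) (L : R) : Prop :=
  0 < L /\ (forall p, disk p -> Rabs (f p) <= L) /\
  forall p q, disk p -> disk q -> Rabs (f p - f q) <= L * dist1 p q.

(** Extensions of [f] exist only locally, so the uniform constant comes from compactness of the
    square [-1, 1]^2 containing the disk. *)
Lemma smooth_lipschitz_on_disk (f : R * R -> R) :
  smooth f -> exists L, lipschitz_on_disk f L.
Proof.
  intros Hf.
  (* A single [d] is both a radius and the inverse of the constant, so that a lower bound on [d]
     controls everything at once. The radius 2d covers a point within d of (u, v) together with its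
     own d-neighbourhood. Around points off the disk, [Q] holds vacuously. *)
  set (Q := fun (u v : R) (d : posreal) =>
    (forall p, near (2 * d) (u, v) p -> disk p -> Rabs (f p) <= / d) /\
    (forall p q, near (2 * d) (u, v) p -> near (2 * d) (u, v) q -> disk p -> disk q ->
       Rabs (f p - f q) <= / d * dist1 p q)).
  assert (HQ : forall u v, exists d, Q u v d).
  { intros u v. destruct (classic (disk (u, v))) as [Hc | Hc].
    - destruct (smooth_locally_lipschitz f (u, v) Hf Hc) as (d & K & Hd & HK & H1 & H2).
      assert (HKi : 0 < / K) by now apply Rinv_0_lt_compat.
      assert (He : 0 < Rmin (d / 2) (/ K)) by (apply Rmin_case; lra).
      exists (mkposreal _ He). unfold Q; simpl.
      set (e := Rmin (d / 2) (/ K)) in *.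
      assert (e1 : e <= d / 2) by apply Rmin_l. assert (e2 : e <= / K) by apply Rmin_r.
      assert (e3 : K <= / e).
      { rewrite <- (Rinv_inv K). now apply Rinv_le_contravar. }
      assert (Hn : forall p, near (2 * e) (u, v) p -> near d (u, v) p)
        by (intros p [A B]; split; lra).
      split.
      + intros p Np Dp. apply Rle_trans with K; [now apply H1, Dp; apply Hn | exact e3].
      + intros p q Np Nq Dp Dq. apply Rle_trans with (K * dist1 p q).
        * apply H2; trivial; now apply Hn.
        * apply Rmult_le_compat_r; [apply dist1_pos | exact e3].
    - destruct (disk_closed (u, v) Hc) as (d & Hd & H).
      assert (Hd2 : 0 < d / 2) by lra. exists (mkposreal _ Hd2). unfold Q; simpl.
      replace (2 * (d / 2)) with d by field.
      split; intros; exfalso; now apply (H p). }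
  set (delta := fun u v => proj1_sig (constructive_indefinite_description _ (HQ u v))).
  assert (Hdelta : forall u v, Q u v (delta u v)).
  { intros u v. unfold delta. apply proj2_sig. }
  destruct (compactness_value_2d (-1) 1 (-1) 1 delta) as [d Hd].
  assert (Hd0 := cond_pos d). assert (Hdi : 0 < / d) by now apply Rinv_0_lt_compat.
  assert (HL : forall p, disk p -> Rabs (f p) <= / d /\
    forall q, disk q -> near d p q -> Rabs (f p - f q) <= / d * dist1 p q).
  { intros p Dp. destruct (disk_bounds p Dp) as [B1 B2].
    destruct (NNPP _ (Hd (fst p) (snd p) B1 B2)) as (u & v & _ & _ & C1 & C2 & C3).
    destruct (Hdelta u v) as [Q1 Q2].
    assert (Hi : / delta u v <= / d) by (apply Rinv_le_contravar; [apply cond_pos | exact C3]).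
    assert (Np : near (2 * delta u v) (u, v) p) by (split; simpl; lra).
    split.
    - eapply Rle_trans; [now apply Q1 | exact Hi].
    - intros q Dq [N1 N2].
      apply Rle_trans with (/ delta u v * dist1 p q);
        [| apply Rmult_le_compat_r; [apply dist1_pos | exact Hi]].
      apply Q2; trivial. split; simpl.
      + replace (fst q - u) with ((fst q - fst p) + (fst p - u)) by ring.
        eapply Rle_lt_trans; [apply Rabs_triang | lra].
      + replace (snd q - v) with ((snd q - snd p) + (snd p - v)) by ring.
        eapply Rle_lt_trans; [apply Rabs_triang | lra]. }
  (* The first term serves pairs that are close. For the others [dist1] is at least [d], and |f(p) -
     f(q)| <= 2/d <= (2/d^2) [dist1 p q]. *)
  exists (/ d + 2 * / d * / d).
  assert (Hdd : 0 < 2 * / d * / d) by nra.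
  split; [lra |]. split.
  - intros p Dp. destruct (HL p Dp) as [H _]. lra.
  - intros p q Dp Dq. destruct (HL p Dp) as [H1 H2]. destruct (HL q Dq) as [H3 _].
    assert (Hpos := dist1_pos p q).
    destruct (classic (near d p q)) as [N | N].
    + eapply Rle_trans; [now apply H2 |]. apply Rmult_le_compat_r; lra.
    + assert (Hge : d <= dist1 p q).
      { apply Rnot_lt_le. intros C. apply N. unfold dist1 in C.
        assert (P1 := Rabs_pos (fst p - fst q)). assert (P2 := Rabs_pos (snd p - snd q)).
        split; rewrite Rabs_minus_sym; lra. }
      assert (T : Rabs (f p - f q) <= 2 * / d).
      { unfold Rminus. eapply Rle_trans; [apply Rabs_triang |]. rewrite Rabs_Ropp. lra. }
      eapply Rle_trans; [exact T |].
      apply Rle_trans with (2 * / d * / d * d); [apply Req_le; field; lra |].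
      rewrite Rmult_plus_distr_r.
      assert (X : 2 * / d * / d * d <= 2 * / d * / d * dist1 p q)
        by (apply Rmult_le_compat_l; lra).
      assert (Y : 0 <= / d * dist1 p q) by (apply Rmult_le_pos; lra). lra.
Qed.

(** * Integral curves: Gronwall's inequality and uniqueness *)

(** Composing with this map extends a function from [a, b] to the whole line by constants, which
    turns one-sided continuity at the endpoints into ordinary continuity. *)
Definition clamp (a b t : R) : R := Rmax a (Rmin t b).

Lemma clamp_id (a b t : R) : a <= t <= b -> clamp a b t = t.
Proof. intros H. unfold clamp. rewrite Rmin_left, Rmax_right; lra. Qed.

Lemma clamp_in (a b t : R) : a <= b -> a <= clamp a b t <= b.
Proof.
  intros H. unfold clamp. split; [apply Rmax_l |].
  apply Rmax_lub; [exact H | apply Rmin_r].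
Qed.

Lemma clamp_lipschitz (a b s t : R) : Rabs (clamp a b s - clamp a b t) <= Rabs (s - t).
Proof.
  unfold clamp, Rmin.
  destruct (Rle_dec s b), (Rle_dec t b); unfold Rmax;
    repeat match goal with |- context [Rle_dec ?x ?y] => destruct (Rle_dec x y) end;
    unfold Rabs;
    repeat match goal with |- context [Rcase_abs ?x] => destruct (Rcase_abs x) end; lra.
Qed.

Lemma continuity_pt_eps (f : R -> R) (x : R) :
  (forall eps, 0 < eps -> exists d, 0 < d /\ forall y, Rabs (y - x) < d -> Rabs (f y - f x) < eps) ->
  continuity_pt f x.
Proof.
  intros H eps He. destruct (H eps He) as (d & Hd & K).
  exists d. split; [exact Hd |]. intros y [_ Hy]. now apply K.
Qed.

Lemma continuity_pt_eps_inv (f : R -> R) (x eps : R) :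
  continuity_pt f x -> 0 < eps ->
  exists d, 0 < d /\ forall y, Rabs (y - x) < d -> Rabs (f y - f x) < eps.
Proof.
  intros H He. destruct (H eps He) as (d & Hd & K).
  exists d. split; [exact Hd |]. intros y Hy.
  destruct (Req_dec y x) as [-> | Hne].
  - rewrite Rminus_diag, Rabs_R0. exact He.
  - apply K. repeat split; [| exact Hy]. intros C. now apply Hne.
Qed.

Lemma continuity_pt_clamp (a b t : R) : continuity_pt (clamp a b) t.
Proof.
  apply continuity_pt_eps. intros eps He. exists eps. split; [exact He |].
  intros y Hy. eapply Rle_lt_trans; [apply clamp_lipschitz | exact Hy].
Qed.

(** Scalar epsilon-delta form of the restricted differential in [integral_curve]; it is one-sided at
    an endpoint of [I]. *)
Definition derivative_within (I : R -> Prop) (f : R -> R) (t l : R) : Prop :=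
  forall eps, 0 < eps -> exists d, 0 < d /\
    forall s, I s -> Rabs (s - t) < d ->
      Rabs (f s - f t - (s - t) * l) <= eps * Rabs (s - t).

Lemma derivative_within_continuity (I : R -> Prop) (f : R -> R) (a b t l : R) :
  (forall s, a <= s <= b -> I s) -> a <= b ->
  derivative_within I f (clamp a b t) l ->
  continuity_pt (fun s => f (clamp a b s)) t.
Proof.
  intros HI Hab H. apply continuity_pt_eps. intros eps He.
  destruct (H 1 Rlt_0_1) as (d & Hd & K).
  assert (Hl := Rabs_pos l).
  assert (He' : 0 < eps / (Rabs l + 2)) by (apply Rdiv_lt_0_compat; lra).
  exists (Rmin d (eps / (Rabs l + 2))). split; [now apply Rmin_case |].
  intros y Hy.
  assert (M1 := Rmin_l d (eps / (Rabs l + 2))). assert (M2 := Rmin_r d (eps / (Rabs l + 2))).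
  set (c := clamp a b) in *.
  assert (Hc := clamp_lipschitz a b y t). fold c in Hc.
  assert (B := K (c y) (HI _ (clamp_in a b y Hab)) ltac:(lra)).
  apply Rle_lt_trans with ((Rabs l + 1) * Rabs (c y - c t)).
  - replace (f (c y) - f (c t)) with ((f (c y) - f (c t) - (c y - c t) * l) + (c y - c t) * l) by ring.
    eapply Rle_trans; [apply Rabs_triang |]. rewrite (Rabs_mult (c y - c t)). lra.
  - apply Rle_lt_trans with ((Rabs l + 1) * (eps / (Rabs l + 2))).
    + apply Rmult_le_compat_l; lra.
    + apply Rlt_le_trans with ((Rabs l + 2) * (eps / (Rabs l + 2)));
        [apply Rmult_lt_compat_r; lra | apply Req_le; field; lra].
Qed.

Lemma is_derive_eps (f : R -> R) (t l : R) :
  (forall eps, 0 < eps -> exists d, 0 < d /\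
    forall s, Rabs (s - t) < d -> Rabs (f s - f t - (s - t) * l) <= eps * Rabs (s - t)) ->
  is_derive f t l.
Proof.
  intros H. split; [apply is_linear_scal_l |].
  intros x Hx. apply (is_filter_lim_locally_unique (V := R_NormedModule)) in Hx. subst x.
  intros eps. destruct (H eps (cond_pos eps)) as (d & Hd & K).
  exists (mkposreal d Hd). intros s Hs. apply K, Hs.
Qed.

Lemma is_derive_eps_inv (f : R -> R) (t l : R) :
  is_derive f t l -> derivative_within (fun _ => True) f t l.
Proof.
  intros [_ H] eps He. destruct (H t (fun P HP => HP) (mkposreal eps He)) as [d Hd].
  exists d. split; [apply cond_pos |]. intros s _ Hs. apply (Hd s Hs).
Qed.

Lemma derivative_within_is_derive (I : R -> Prop) (f : R -> R) (a b t l : R) :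
  (forall s, a <= s <= b -> I s) -> a < t < b ->
  derivative_within I f t l -> is_derive (fun s => f (clamp a b s)) t l.
Proof.
  intros HI Ht H. apply is_derive_eps. intros eps He.
  destruct (H eps He) as (d & Hd & K).
  exists (Rmin d (Rmin (t - a) (b - t))). split.
  - repeat apply Rmin_case; lra.
  - intros s Hs.
    assert (M1 := Rmin_l d (Rmin (t - a) (b - t))).
    assert (M2 := Rmin_r d (Rmin (t - a) (b - t))).
    assert (M3 := Rmin_l (t - a) (b - t)). assert (M4 := Rmin_r (t - a) (b - t)).
    assert (Hs' : - Rmin (t - a) (b - t) < s - t < Rmin (t - a) (b - t))
      by (apply Rabs_def2 in Hs; lra).
    rewrite (clamp_id a b t), (clamp_id a b s) by lra.
    apply K; [apply HI; lra | lra].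
Qed.

(** Coordinatewise equivalent of [integral_curve]; the two conversions below allow all estimates to
    be made on real functions. *)
Definition curve (X : vector_field) (I : R -> Prop) (gamma : R -> R * R) : Prop :=
  forall t, I t -> disk (gamma t) /\
    derivative_within I (fun s => fst (gamma s)) t (fst (X (gamma t))) /\
    derivative_within I (fun s => snd (gamma s)) t (snd (X (gamma t))).

Lemma integral_curve_curve (X : vector_field) (I : R -> Prop) (gamma : R -> R * R) :
  integral_curve X I gamma -> curve X I gamma.
Proof.
  intros H t Ht. destruct (H t Ht) as [D [_ Hd]]. split; [exact D |].
  assert (K : forall eps, 0 < eps -> exists d, 0 < d /\ forall s, I s -> Rabs (s - t) < d ->
    norm (minus (minus (gamma s) (gamma t)) (scal (s - t) (X (gamma t)))) <= eps * Rabs (s - t)).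
  { intros eps He.
    destruct (Hd t) with (eps := mkposreal eps He) as [d Hd'].
    - intros P HP. unfold within. revert HP. apply filter_imp. now intros x Px _.
    - exists d. split; [apply cond_pos |]. intros s Is Hs. apply (Hd' s Hs Is). }
  split; intros eps He; destruct (K eps He) as (d & Hd' & K'); exists d;
    (split; [exact Hd' |]); intros s Is Hs;
    (eapply Rle_trans; [| apply (K' s Is Hs)]);
    rewrite (surjective_pairing (minus _ _)).
  - eapply Rle_trans; [| apply norm_prod]. apply Rmax_l.
  - eapply Rle_trans; [| apply norm_prod]. apply Rmax_r.
Qed.

Lemma curve_integral_curve (X : vector_field) (I : R -> Prop) (gamma : R -> R * R) :
  curve X I gamma -> integral_curve X I gamma.
Proof.
  intros H t Ht. destruct (H t Ht) as (D & H1 & H2). split; [exact D |].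
  split; [apply (is_linear_scal_l (V := prod_NormedModule _ R_NormedModule R_NormedModule)) |].
  intros x Hx.
  assert (x = t) as ->.
  { apply eq_close. intros eps.
    assert (L : locally x (ball x eps)) by (exists eps; now intros).
    apply Hx in L. apply locally_singleton in L. now apply L. }
  intros eps.
  (* [norm_prod] bounds the norm of a pair by sqrt 2 times its larger component. *)
  assert (Hs2 : 0 < sqrt 2) by (apply sqrt_lt_R0; lra).
  assert (He : 0 < eps / sqrt 2) by (apply Rdiv_lt_0_compat; [apply cond_pos | exact Hs2]).
  destruct (H1 _ He) as (d1 & Hd1 & K1). destruct (H2 _ He) as (d2 & Hd2 & K2).
  assert (Hm : 0 < Rmin d1 d2) by now apply Rmin_case.
  exists (mkposreal _ Hm). intros s Hs Is.
  assert (M1 := Rmin_l d1 d2). assert (M2 := Rmin_r d1 d2).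
  assert (Hs' : Rabs (s - t) < Rmin d1 d2) by exact Hs.
  specialize (K1 s Is ltac:(lra)). specialize (K2 s Is ltac:(lra)).
  change (norm (minus s t)) with (Rabs (s - t)).
  match goal with |- norm ?v <= _ => rewrite (surjective_pairing v) end.
  eapply Rle_trans; [apply norm_prod |].
  apply Rle_trans with (sqrt 2 * (eps / sqrt 2 * Rabs (s - t))).
  - apply Rmult_le_compat_l; [lra |]. apply Rmax_lub; [exact K1 | exact K2].
  - apply Req_le. field. lra.
Qed.

Lemma curve_restrict (X : vector_field) (I J : R -> Prop) (gamma : R -> R * R) :
  (forall t, J t -> I t) -> curve X I gamma -> curve X J gamma.
Proof.
  intros HJ H t Ht. destruct (H t (HJ t Ht)) as (D & H1 & H2). split; [exact D |].
  split; intros eps He; [destruct (H1 eps He) as (d & Hd & K) | destruct (H2 eps He) as (d & Hd & K)];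
    exists d; split; trivial; intros s Js; now apply K, HJ.
Qed.

Lemma curve_shift (X : vector_field) (I : R -> Prop) (gamma : R -> R * R) (c : R) :
  curve X I gamma -> curve X (fun t => I (t + c)) (fun t => gamma (t + c)).
Proof.
  intros H t Ht. destruct (H _ Ht) as (D & H1 & H2). split; [exact D |].
  split; intros eps He; [destruct (H1 eps He) as (d & Hd & K) | destruct (H2 eps He) as (d & Hd & K)];
    exists d; split; trivial; intros s Is Hs;
    replace (s - t) with (s + c - (t + c)) by ring; apply K; trivial;
    now replace (s + c - (t + c)) with (s - t) by ring.
Qed.

Lemma curve_clamped (X : vector_field) (I : R -> Prop) (gamma : R -> R * R) (a b : R) :
  curve X I gamma -> a <= b -> (forall s, a <= s <= b -> I s) ->
  (forall t, continuity_pt (fun s => fst (gamma (clamp a b s))) t) /\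
  (forall t, continuity_pt (fun s => snd (gamma (clamp a b s))) t) /\
  (forall t, a < t < b ->
    is_derive (fun s => fst (gamma (clamp a b s))) t (fst (X (gamma t))) /\
    is_derive (fun s => snd (gamma (clamp a b s))) t (snd (X (gamma t)))).
Proof.
  intros H Hab HI.
  split; [| split; [| intros t Ht; split]].
  - intros t. destruct (H (clamp a b t)) as (_ & H1 & _); [now apply HI, clamp_in |].
    now apply (derivative_within_continuity I (fun s => fst (gamma s)) a b t _ HI Hab H1).
  - intros t. destruct (H (clamp a b t)) as (_ & _ & H1); [now apply HI, clamp_in |].
    now apply (derivative_within_continuity I (fun s => snd (gamma s)) a b t _ HI Hab H1).
  - destruct (H t) as (_ & H1 & _); [apply HI; lra |].
    now apply (derivative_within_is_derive I (fun s => fst (gamma s))).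
  - destruct (H t) as (_ & _ & H1); [apply HI; lra |].
    now apply (derivative_within_is_derive I (fun s => snd (gamma s))).
Qed.

Lemma nonincreasing_of_derivative (p p' : R -> R) (a b : R) :
  a <= b -> (forall t, a <= t <= b -> continuity_pt p t) ->
  (forall t, a < t < b -> is_derive p t (p' t)) ->
  (forall t, a < t < b -> p' t <= 0) -> p b <= p a.
Proof.
  intros Hab Hc Hd Hle.
  (* The intermediate point may be an endpoint, where [p'] is uncontrolled; truncating at 0 changes
     nothing inside and gives the sign everywhere. *)
  destruct (MVT_gen p a b (fun t => Rmin 0 (p' t))) as (c & _ & E).
  - rewrite Rmin_left, Rmax_right by lra. intros t Ht.
    rewrite Rmin_right by now apply Hle. now apply Hd.
  - now rewrite Rmin_left, Rmax_right by lra.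
  - assert (K := Rmin_l 0 (p' c)). nra.
Qed.

Lemma increasing_of_derivative (p p' : R -> R) (a b : R) :
  a < b -> (forall t, a <= t <= b -> continuity_pt p t) ->
  (forall t, a < t < b -> is_derive p t (p' t)) ->
  (forall t, a < t < b -> 0 < p' t) -> p a < p b.
Proof.
  intros Hab Hc Hd Hlt.
  set (q := fun t => if Rlt_dec 0 (p' t) then p' t else 1).
  destruct (MVT_gen p a b q) as (c & _ & E).
  - rewrite Rmin_left, Rmax_right by lra. intros t Ht. unfold q.
    destruct (Rlt_dec 0 (p' t)) as [_ | n]; [now apply Hd | elim n; now apply Hlt].
  - now rewrite Rmin_left, Rmax_right by lra.
  - assert (K : 0 < q c) by (unfold q; destruct (Rlt_dec 0 (p' c)); lra). nra.
Qed.

(** Adding E/K makes the inequality homogeneous: q = p + E/K satisfies q' <= K q, so q(t) exp(-K t)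
    does not increase. *)
Lemma gronwall (p p' : R -> R) (a b K E : R) :
  a <= b -> 0 < K -> (forall t, a <= t <= b -> continuity_pt p t) ->
  (forall t, a < t < b -> is_derive p t (p' t)) ->
  (forall t, a < t < b -> p' t <= K * p t + E) ->
  p b + E / K <= (p a + E / K) * exp (K * (b - a)).
Proof.
  intros Hab HK Hc Hd Hle.
  assert (H : (p b + E / K) * exp (- K * b) <= (p a + E / K) * exp (- K * a)).
  { apply (nonincreasing_of_derivative (fun t => (p t + E / K) * exp (- K * t))
      (fun t => (p' t - K * p t - E) * exp (- K * t))); trivial.
    - intros t Ht. apply continuity_pt_mult.
      + apply continuity_pt_plus; [now apply Hc | now apply continuity_pt_const].
      + apply (is_derive_continuity_pt _ _ (- K * exp (- K * t))).
        auto_derive; [trivial | ring].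
    - intros t Ht.
      assert (Hx := Hd t Ht).
      assert (Ex : ex_derive p t) by now exists (p' t).
      auto_derive; [exact Ex |]. change (Derive (fun s : R => p s) t) with (Derive p t).
      rewrite (is_derive_unique _ _ _ Hx). field. lra.
    - intros t Ht. assert (X := exp_pos (- K * t)). specialize (Hle t Ht). nra. }
  apply Rmult_le_compat_r with (r := exp (K * b)) in H; [| left; apply exp_pos].
  rewrite !Rmult_assoc, <- !exp_plus in H.
  replace (- K * b + K * b) with 0 in H by ring. rewrite exp_0, Rmult_1_r in H.
  now replace (- K * a + K * b) with (K * (b - a)) in H by ring.
Qed.

(** The forward inequality for t -> p(-t). *)
Lemma gronwall_backward (p p' : R -> R) (a b K : R) :
  a <= b -> 0 < K -> (forall t, a <= t <= b -> continuity_pt p t) ->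
  (forall t, a < t < b -> is_derive p t (p' t)) ->
  (forall t, a < t < b -> - (K * p t) <= p' t) ->
  p a <= p b * exp (K * (b - a)).
Proof.
  intros Hab HK Hc Hd Hle.
  assert (H := gronwall (fun t => p (- t)) (fun t => - p' (- t)) (- b) (- a) K 0).
  cbv beta in H. rewrite !Ropp_involutive in H.
  unfold Rdiv in H. rewrite !Rmult_0_l, !Rplus_0_r in H.
  replace (- a - - b) with (b - a) in H by ring. apply H; try lra.
  - intros t Ht. apply (continuity_pt_comp Ropp p).
    + apply (is_derive_continuity_pt _ _ (-1)). auto_derive; [trivial | ring].
    + apply Hc; lra.
  - intros t Ht. replace (- p' (- t)) with (-1 * p' (- t)) by ring.
    apply (is_derive_comp p Ropp); [apply Hd; lra |].
    auto_derive; [trivial | ring].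
  - intros t Ht. specialize (Hle (- t) ltac:(lra)). lra.
Qed.

Definition lipschitz_field (X : vector_field) (L : R) : Prop :=
  lipschitz_on_disk (fun p => fst (X p)) L /\ lipschitz_on_disk (fun p => snd (X p)) L.

Lemma smooth_lipschitz_field (X : vector_field) :
  smooth_vector_field X -> exists L, lipschitz_field X L.
Proof.
  intros [H1 H2].
  destruct (smooth_lipschitz_on_disk _ H1) as (L1 & P1 & B1 & C1).
  destruct (smooth_lipschitz_on_disk _ H2) as (L2 & P2 & B2 & C2).
  exists (L1 + L2). repeat split; try lra.
  - intros p Dp. specialize (B1 p Dp). lra.
  - intros p q Dp Dq. eapply Rle_trans; [now apply C1 |].
    apply Rmult_le_compat_r; [apply dist1_pos | lra].
  - intros p Dp. specialize (B2 p Dp). lra.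
  - intros p q Dp Dq. eapply Rle_trans; [now apply C2 |].
    apply Rmult_le_compat_r; [apply dist1_pos | lra].
Qed.

(** With (u, v) the derivative of (x, y), the left side is |(x^2 + y^2)'|. The 4 comes from the
    factor 2 and (|x| + |y|)^2 <= 2(x^2 + y^2). *)
Lemma quadratic_form_bound (x y u v L : R) :
  0 < L -> Rabs u <= L * (Rabs x + Rabs y) -> Rabs v <= L * (Rabs x + Rabs y) ->
  Rabs (2 * x * u + 2 * y * v) <= 4 * L * (x ^ 2 + y ^ 2).
Proof.
  intros HL Hu Hv.
  assert (Hx := Rabs_pos x). assert (Hy := Rabs_pos y).
  assert (Ex : x ^ 2 = Rabs x ^ 2) by (symmetry; apply pow2_abs).
  assert (Ey : y ^ 2 = Rabs y ^ 2) by (symmetry; apply pow2_abs).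
  eapply Rle_trans; [apply Rabs_triang |].
  rewrite !Rabs_mult, (Rabs_pos_eq 2), Ex, Ey by lra.
  assert (A : Rabs x * Rabs u <= Rabs x * (L * (Rabs x + Rabs y))) by now apply Rmult_le_compat_l.
  assert (B : Rabs y * Rabs v <= Rabs y * (L * (Rabs x + Rabs y))) by now apply Rmult_le_compat_l.
  assert (C : 0 <= L * (Rabs x - Rabs y) ^ 2) by (apply Rmult_le_pos; [lra | apply pow2_ge_0]).
  nra.
Qed.

Lemma is_derive_sum_squares (u v : R -> R) (t u' v' : R) :
  is_derive u t u' -> is_derive v t v' ->
  is_derive (fun s => u s ^ 2 + v s ^ 2) t (2 * u t * u' + 2 * v t * v').
Proof.
  intros Hu Hv. auto_derive; [split; [now exists u' | split; [now exists v' | trivial]] |].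
  change (Derive (fun s : R => u s) t) with (Derive u t).
  change (Derive (fun s : R => v s) t) with (Derive v t).
  rewrite (is_derive_unique _ _ _ Hu), (is_derive_unique _ _ _ Hv). ring.
Qed.

(** The squared distance [P] of the two curves satisfies |P'| <= 4 L P and vanishes at 0. Gronwall
    gives P = 0 for later times, and its backward form for earlier ones. *)
Lemma curve_unique (X : vector_field) (L : R) (I : R -> Prop) (beta gamma : R -> R * R) :
  lipschitz_field X L -> is_interval I -> I 0 -> curve X I beta -> curve X I gamma ->
  beta 0 = gamma 0 -> forall t, I t -> beta t = gamma t.
Proof.
  intros [(HL & _ & L1) (_ & _ & L2)] HI I0 Hb Hg H0 t It.
  set (P := fun s => (fst (beta s) - fst (gamma s)) ^ 2 + (snd (beta s) - snd (gamma s)) ^ 2).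
  assert (P0 : P 0 = 0) by (unfold P; rewrite H0; ring).
  assert (HP : forall a b, a <= b -> (forall s, a <= s <= b -> I s) ->
    P b <= P a * exp (4 * L * (b - a)) /\ P a <= P b * exp (4 * L * (b - a))).
  { intros a b Hab HIab.
    destruct (curve_clamped X I beta a b Hb Hab HIab) as (B1 & B2 & B3).
    destruct (curve_clamped X I gamma a b Hg Hab HIab) as (G1 & G2 & G3).
    set (p := fun s => P (clamp a b s)).
    set (p' := fun s => 2 * (fst (beta s) - fst (gamma s)) * (fst (X (beta s)) - fst (X (gamma s)))
      + 2 * (snd (beta s) - snd (gamma s)) * (snd (X (beta s)) - snd (X (gamma s)))).
    assert (Hc : forall s, a <= s <= b -> continuity_pt p s).
    { intros s _. apply continuity_pt_plus;
        apply (continuity_pt_comp _ (fun z => z ^ 2));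
        try (apply continuity_pt_minus; trivial);
        apply (is_derive_continuity_pt _ _ _ (is_derive_pow _ _ _ _ (is_derive_id _))). }
    assert (Hd : forall s, a < s < b -> is_derive p s (p' s)).
    { intros s Hs. destruct (B3 s Hs) as [D1 D2]. destruct (G3 s Hs) as [D3 D4].
      assert (E : clamp a b s = s) by (apply clamp_id; lra).
      assert (D := is_derive_sum_squares _ _ _ _ _
        (is_derive_minus _ _ _ _ _ D1 D3) (is_derive_minus _ _ _ _ _ D2 D4)).
      unfold minus, plus, opp in D; simpl in D. rewrite E in D. exact D. }
    assert (Hbd : forall s, a < s < b -> Rabs (p' s) <= 4 * L * p s).
    { intros s Hs. unfold p. rewrite clamp_id by lra.
      assert (Is : I s) by (apply HIab; lra).
      destruct (Hb s Is) as [Db _]. destruct (Hg s Is) as [Dg _].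
      apply quadratic_form_bound; [exact HL | now apply L1 | now apply L2]. }
    assert (Ea : p a = P a) by (unfold p; rewrite clamp_id; lra || reflexivity).
    assert (Eb : p b = P b) by (unfold p; rewrite clamp_id; lra || reflexivity).
    rewrite <- Ea, <- Eb. split.
    - assert (G := gronwall p p' a b (4 * L) 0 Hab ltac:(lra) Hc Hd).
      unfold Rdiv in G. rewrite Rmult_0_l, !Rplus_0_r in G. apply G.
      intros s Hs. specialize (Hbd s Hs). apply Rabs_le_between in Hbd. lra.
    - apply (gronwall_backward p p' a b (4 * L) Hab); trivial; [lra |].
      intros s Hs. specialize (Hbd s Hs). apply Rabs_le_between in Hbd. lra. }
  assert (Pt : P t <= 0).
  { destruct (Rle_dec 0 t) as [Ht | Ht].
    - destruct (HP 0 t Ht) as [H _]; [intros s Hs; now apply (HI 0 t) | rewrite P0 in H; lra].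
    - destruct (HP t 0) as [_ H]; [lra | intros s Hs; now apply (HI t 0) | rewrite P0 in H; lra]. }
  unfold P in Pt.
  assert (S1 := pow2_ge_0 (fst (beta t) - fst (gamma t))).
  assert (S2 := pow2_ge_0 (snd (beta t) - snd (gamma t))).
  rewrite (surjective_pairing (beta t)), (surjective_pairing (gamma t)).
  f_equal; nra.
Qed.

(** * Integral curves: local existence *)

Lemma pow_half_pos (n : nat) : 0 < (/ 2) ^ n.
Proof. apply pow_lt. lra. Qed.

Lemma is_lim_seq_scal_pow_half (D : R) : is_lim_seq (fun n => D * (/ 2) ^ n) 0.
Proof.
  replace (Finite 0) with (Rbar_mult D 0) by (simpl; f_equal; ring).
  apply is_lim_seq_scal_l, is_lim_seq_geom. rewrite Rabs_pos_eq; lra.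
Qed.

Lemma pow_half_small (D eps : R) : 0 < eps -> exists n, D * (/ 2) ^ n < eps.
Proof.
  intros He. destruct (is_lim_seq_scal_pow_half D (fun x => x < eps)) as [N H].
  - exists (mkposreal eps He). intros y Hy.
    change (Rabs (y - 0) < eps) in Hy. apply Rabs_def2 in Hy. simpl in Hy. lra.
  - exists N. now apply H.
Qed.

Lemma le_0_of_le_pow_half (x D : R) : (forall n, x <= D * (/ 2) ^ n) -> x <= 0.
Proof.
  intros H. apply Rnot_lt_le. intros Hx.
  destruct (pow_half_small D x Hx) as [n Hn]. specialize (H n). lra.
Qed.

Lemma uniform_limit (w : nat -> R -> R) (D : R) :
  (forall n k t, Rabs (w (n + k)%nat t - w n t) <= D * (/ 2) ^ n) ->
  (forall n t, continuity_pt (w n) t) ->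
  exists W, (forall n t, Rabs (w n t - W t) <= D * (/ 2) ^ n) /\
    forall t, continuity_pt W t.
Proof.
  intros Hw Hc.
  set (W := fun t => real (Lim_seq (fun n => w n t))).
  assert (HW : forall t, is_lim_seq (fun n => w n t) (W t)).
  { intros t. apply Lim_seq_correct'. apply ex_lim_seq_cauchy_corr.
    intros eps. destruct (pow_half_small D (eps / 2)) as [N HN]; [assert (K := cond_pos eps); lra |].
    exists N. intros n m Hn Hm.
    assert (A := Hw N (n - N)%nat t). assert (B := Hw N (m - N)%nat t).
    replace (N + (n - N))%nat with n in A by lia. replace (N + (m - N))%nat with m in B by lia.
    replace (w n t - w m t) with ((w n t - w N t) - (w m t - w N t)) by ring.
    eapply Rle_lt_trans; [apply Rabs_triang |]. rewrite Rabs_Ropp. lra. }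
  assert (HD : forall n t, Rabs (w n t - W t) <= D * (/ 2) ^ n).
  { intros n t.
    assert (L : is_lim_seq (fun k => Rabs (w n t - w (k + n)%nat t)) (Rabs (w n t - W t))).
    { apply (is_lim_seq_abs _ (Finite _)). apply is_lim_seq_minus'; [apply is_lim_seq_const |].
      apply (is_lim_seq_incr_n (fun k => w k t)). apply HW. }
    apply (is_lim_seq_le _ _ (Finite _) (Finite _)) with (2 := L) (3 := is_lim_seq_const _).
    intros k. rewrite Rabs_minus_sym, Nat.add_comm. apply Hw. }
  exists W. split; [exact HD |].
  intros t. apply continuity_pt_eps. intros eps He.
  destruct (pow_half_small D (eps / 3)) as [n Hn]; [lra |].
  destruct (continuity_pt_eps_inv _ t (eps / 3) (Hc n t)) as (d & Hd & K); [lra |].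
  exists d. split; [exact Hd |]. intros y Hy. specialize (K y Hy).
  assert (A := HD n y). assert (B := HD n t).
  replace (W y - W t) with (- (w n y - W y) + (w n y - w n t) + (w n t - W t)) by ring.
  eapply Rle_lt_trans; [apply Rabs_triang |].
  assert (T := Rabs_triang (- (w n y - W y)) (w n y - w n t)). rewrite Rabs_Ropp in T. lra.
Qed.

Lemma continuity_ex_RInt (g : R -> R) (a b : R) :
  (forall t, continuity_pt g t) -> ex_RInt g a b.
Proof.
  intros H. apply (ex_RInt_continuous (V := R_CompleteNormedModule)).
  intros t _. now apply continuity_pt_filterlim.
Qed.

Lemma RInt_continuity_is_derive (g : R -> R) (t : R) :
  (forall s, continuity_pt g s) -> is_derive (fun s => RInt g 0 s) t (g t).
Proof.
  intros H. apply (is_derive_RInt (V := R_NormedModule) g _ 0).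
  - apply filter_forall. intros s. apply (RInt_correct (V := R_CompleteNormedModule)).
    now apply continuity_ex_RInt.
  - now apply continuity_pt_filterlim.
Qed.

Lemma abs_RInt_from_0_le (g : R -> R) (M h t : R) :
  (forall s, continuity_pt g s) -> (forall s, Rabs (g s) <= M) -> - h <= t <= h ->
  Rabs (RInt g 0 t) <= h * M.
Proof.
  intros Hc HM Ht.
  assert (HM0 : 0 <= M) by (eapply Rle_trans; [apply Rabs_pos | apply (HM 0)]).
  destruct (Rle_dec 0 t) as [H0 | H0].
  - apply Rle_trans with ((t - 0) * M); [| apply Rmult_le_compat_r; lra].
    apply abs_RInt_le_const; [lra | now apply continuity_ex_RInt | intros; apply HM].
  - rewrite <- (opp_RInt_swap (V := R_CompleteNormedModule)) by now apply continuity_ex_RInt.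
    change (Rabs (- RInt g t 0) <= h * M). rewrite Rabs_Ropp.
    apply Rle_trans with ((0 - t) * M); [| apply Rmult_le_compat_r; lra].
    apply abs_RInt_le_const; [lra | now apply continuity_ex_RInt | intros; apply HM].
Qed.

Lemma lipschitz_continuity_pt (f : R -> R -> R) (L : R) (u v : R -> R) (t : R) :
  0 < L ->
  (forall x y x' y', Rabs (f x y - f x' y') <= L * (Rabs (x - x') + Rabs (y - y'))) ->
  continuity_pt u t -> continuity_pt v t -> continuity_pt (fun s => f (u s) (v s)) t.
Proof.
  intros HL Hf Hu Hv. apply continuity_pt_eps. intros eps He.
  assert (He' : 0 < eps / (2 * L)) by (apply Rdiv_lt_0_compat; lra).
  destruct (continuity_pt_eps_inv _ _ _ Hu He') as (d1 & Hd1 & K1).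
  destruct (continuity_pt_eps_inv _ _ _ Hv He') as (d2 & Hd2 & K2).
  exists (Rmin d1 d2). split; [now apply Rmin_case |]. intros y Hy.
  assert (M1 := Rmin_l d1 d2). assert (M2 := Rmin_r d1 d2).
  specialize (K1 y ltac:(lra)). specialize (K2 y ltac:(lra)).
  eapply Rle_lt_trans; [apply Hf |].
  apply Rlt_le_trans with (L * (eps / (2 * L) + eps / (2 * L)));
    [apply Rmult_lt_compat_l; lra | apply Req_le; field; lra].
Qed.

(** * Picard iteration for a globally Lipschitz planar system *)

Section Picard.

Variables (f1 f2 : R -> R -> R) (L p1 p2 : R).
Hypothesis HL : 0 < L.
Hypothesis Lip1 : forall x y x' y',
  Rabs (f1 x y - f1 x' y') <= L * (Rabs (x - x') + Rabs (y - y')).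
Hypothesis Lip2 : forall x y x' y',
  Rabs (f2 x y - f2 x' y') <= L * (Rabs (x - x') + Rabs (y - y')).

(** With this step each component of the Volterra map contributes a factor h L = 1/4, so the sum of
    the two distances is halved at each iteration. *)
Let h : R := / (4 * L).

(* Clamping the upper bound of the integral to [-h, h] makes the contraction
   estimates uniform over the whole line. *)
Let volterra (f : R -> R -> R) (p : R) (u v : R -> R) (t : R) : R :=
  p + RInt (fun s => f (u s) (v s)) 0 (clamp (- h) h t).

Fixpoint picard_iterate (n : nat) : (R -> R) * (R -> R) :=
  match n with
  | O => ((fun _ => p1), (fun _ => p2))
  | S m => let (u, v) := picard_iterate m in (volterra f1 p1 u v, volterra f2 p2 u v)
  end.

Let u_ (n : nat) : R -> R := fst (picard_iterate n).
Let v_ (n : nat) : R -> R := snd (picard_iterate n).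

Lemma picard_step_pos : 0 < h.
Proof. unfold h. apply Rinv_0_lt_compat. lra. Qed.

Lemma picard_iterate_S (n : nat) :
  u_ (S n) = volterra f1 p1 (u_ n) (v_ n) /\ v_ (S n) = volterra f2 p2 (u_ n) (v_ n).
Proof. unfold u_, v_. simpl. now destruct (picard_iterate n). Qed.

Lemma volterra_continuity (f : R -> R -> R) (p : R) (u v : R -> R) (t : R) :
  (forall s, continuity_pt (fun s => f (u s) (v s)) s) ->
  continuity_pt (volterra f p u v) t.
Proof.
  intros H. apply continuity_pt_plus; [now apply continuity_pt_const |].
  apply (continuity_pt_comp (clamp (- h) h) (fun s => RInt _ 0 s)).
  - apply continuity_pt_clamp.
  - eapply is_derive_continuity_pt. now apply RInt_continuity_is_derive.
Qed.

Lemma picard_continuity (n : nat) :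
  (forall t, continuity_pt (u_ n) t) /\ (forall t, continuity_pt (v_ n) t).
Proof.
  induction n as [|n [IHu IHv]].
  - split; intros t; now apply continuity_pt_const.
  - destruct (picard_iterate_S n) as [-> ->].
    split; intros t; apply volterra_continuity; intros s;
      now apply (lipschitz_continuity_pt _ L).
Qed.

Lemma volterra_lipschitz (f : R -> R -> R) (p M : R) (u v u' v' : R -> R) (t : R) :
  (forall x y x' y', Rabs (f x y - f x' y') <= L * (Rabs (x - x') + Rabs (y - y'))) ->
  (forall s, continuity_pt u s) -> (forall s, continuity_pt v s) ->
  (forall s, continuity_pt u' s) -> (forall s, continuity_pt v' s) ->
  (forall s, Rabs (u s - u' s) + Rabs (v s - v' s) <= M) ->
  Rabs (volterra f p u v t - volterra f p u' v' t) <= M / 4.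
Proof.
  intros Hf Cu Cv Cu' Cv' HM. unfold volterra.
  assert (C1 : forall s, continuity_pt (fun s => f (u s) (v s)) s)
    by (intros s; now apply (lipschitz_continuity_pt f L)).
  assert (C2 : forall s, continuity_pt (fun s => f (u' s) (v' s)) s)
    by (intros s; now apply (lipschitz_continuity_pt f L)).
  set (c := clamp (- h) h t).
  assert (E : RInt (fun s => f (u s) (v s) - f (u' s) (v' s)) 0 c
      = RInt (fun s => f (u s) (v s)) 0 c - RInt (fun s => f (u' s) (v' s)) 0 c)
    by (apply (RInt_minus (V := R_CompleteNormedModule)); now apply continuity_ex_RInt).
  enough (H : Rabs (RInt (fun s => f (u s) (v s)) 0 c - RInt (fun s => f (u' s) (v' s)) 0 c) <= M / 4).
  { revert H. generalize (RInt (fun s => f (u s) (v s)) 0 c) (RInt (fun s => f (u' s) (v' s)) 0 c).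
    intros y z H. now replace (p + y - (p + z)) with (y - z) by ring. }
  rewrite <- E.
  assert (Hh := picard_step_pos).
  replace (M / 4) with (h * (L * M)) by (unfold h; field; lra).
  apply abs_RInt_from_0_le.
  - intros s. apply (continuity_pt_minus _ _ s (C1 s) (C2 s)).
  - intros s. eapply Rle_trans; [apply Hf |]. apply Rmult_le_compat_l; [lra | apply HM].
  - apply clamp_in. lra.
Qed.

Let D : R := h * (Rabs (f1 p1 p2) + Rabs (f2 p1 p2)).

Lemma picard_increment (n : nat) (t : R) :
  Rabs (u_ (S n) t - u_ n t) + Rabs (v_ (S n) t - v_ n t) <= D * (/ 2) ^ n.
Proof.
  revert t; induction n as [|n IH]; intros t.
  - unfold u_, v_; simpl. unfold volterra, D.
    assert (Hh := picard_step_pos).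
    assert (B : forall p c, Rabs (p + RInt (fun _ => c) 0 (clamp (- h) h t) - p) <= h * Rabs c).
    { intros p c. rewrite Rplus_minus_l.
      apply abs_RInt_from_0_le; [intros; now apply continuity_pt_const | intros; lra |].
      apply clamp_in. lra. }
    assert (B1 := B p1 (f1 p1 p2)). assert (B2 := B p2 (f2 p1 p2)). lra.
  - destruct (picard_continuity n) as [Cu Cv]. destruct (picard_continuity (S n)) as [Cu' Cv'].
    assert (B1 := volterra_lipschitz f1 p1 _ _ _ _ _ t Lip1 Cu' Cv' Cu Cv IH).
    assert (B2 := volterra_lipschitz f2 p2 _ _ _ _ _ t Lip2 Cu' Cv' Cu Cv IH).
    destruct (picard_iterate_S n) as [E1 E2]. destruct (picard_iterate_S (S n)) as [E3 E4].
    rewrite <- E1, <- E3 in B1. rewrite <- E2, <- E4 in B2.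
    rewrite <- tech_pow_Rmult. lra.
Qed.

Lemma picard_cauchy (n k : nat) (t : R) :
  Rabs (u_ (n + k)%nat t - u_ n t) + Rabs (v_ (n + k)%nat t - v_ n t) <= 2 * D * (/ 2) ^ n.
Proof.
  (* Strengthened so that the induction telescopes: D/2^j = 2D/2^j - 2D/2^(j+1). *)
  enough (H : Rabs (u_ (n + k)%nat t - u_ n t) + Rabs (v_ (n + k)%nat t - v_ n t)
      <= 2 * D * (/ 2) ^ n - 2 * D * (/ 2) ^ (n + k)).
  { assert (P := pow_half_pos (n + k)).
    assert (HD : 0 <= D).
    { unfold D. apply Rmult_le_pos; [left; apply picard_step_pos |].
      apply Rplus_le_le_0_compat; apply Rabs_pos. }
    assert (0 <= D * (/ 2) ^ (n + k)) by (apply Rmult_le_pos; lra). lra. }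
  induction k as [|k IH].
  - rewrite Nat.add_0_r, !Rminus_diag, Rabs_R0. lra.
  - assert (B := picard_increment (n + k) t). rewrite Nat.add_succ_r.
    assert (T1 := Rabs_triang (u_ (S (n + k)) t - u_ (n + k)%nat t) (u_ (n + k)%nat t - u_ n t)).
    assert (T2 := Rabs_triang (v_ (S (n + k)) t - v_ (n + k)%nat t) (v_ (n + k)%nat t - v_ n t)).
    replace (u_ (S (n + k)) t - u_ (n + k)%nat t + (u_ (n + k)%nat t - u_ n t))
      with (u_ (S (n + k)) t - u_ n t) in T1 by ring.
    replace (v_ (S (n + k)) t - v_ (n + k)%nat t + (v_ (n + k)%nat t - v_ n t))
      with (v_ (S (n + k)) t - v_ n t) in T2 by ring.
    rewrite <- (tech_pow_Rmult (/ 2) (n + k)). lra.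
Qed.

Lemma picard : exists h u v, 0 < h /\ u 0 = p1 /\ v 0 = p2 /\
  (forall t, continuity_pt u t) /\ (forall t, continuity_pt v t) /\
  forall t, - h < t < h ->
    is_derive u t (f1 (u t) (v t)) /\ is_derive v t (f2 (u t) (v t)).
Proof.
  destruct (uniform_limit u_ (2 * D)) as (u & Hu & Cu).
  { intros n k t. assert (B := picard_cauchy n k t).
    assert (P := Rabs_pos (v_ (n + k)%nat t - v_ n t)). lra. }
  { intros n; apply picard_continuity. }
  destruct (uniform_limit v_ (2 * D)) as (v & Hv & Cv).
  { intros n k t. assert (B := picard_cauchy n k t).
    assert (P := Rabs_pos (u_ (n + k)%nat t - u_ n t)). lra. }
  { intros n; apply picard_continuity. }
  assert (Hclose : forall n s, Rabs (u_ n s - u s) + Rabs (v_ n s - v s) <= 4 * D * (/ 2) ^ n).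
  { intros n s. assert (A := Hu n s). assert (B := Hv n s). lra. }
  (* The limit is a fixed point: iterate n + 1 is within D/2^n of its limit, and also within D/2^n
     of the Volterra image of the limit, by the contraction applied to the bound 4D/2^n. *)
  assert (Hfix : forall f p w (w_ : nat -> R -> R),
    (forall x y x' y', Rabs (f x y - f x' y') <= L * (Rabs (x - x') + Rabs (y - y'))) ->
    (forall n t, Rabs (w_ n t - w t) <= 2 * D * (/ 2) ^ n) ->
    (forall n, w_ (S n) = volterra f p (u_ n) (v_ n)) ->
    forall t, w t = volterra f p u v t).
  { intros f p w w_ Hf Hw Hs t.
    enough (H : Rabs (w t - volterra f p u v t) <= 0).
    { assert (P := Rabs_pos (w t - volterra f p u v t)).
      assert (Z : Rabs (w t - volterra f p u v t) = 0) by lra.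
      apply Rabs_eq_0 in Z. lra. }
    apply (le_0_of_le_pow_half _ (2 * D)). intros n.
    destruct (picard_continuity n) as [Cn Cn'].
    assert (B1 := volterra_lipschitz f p _ _ _ _ _ t Hf Cn Cn' Cu Cv (Hclose n)).
    assert (B2 := Hw (S n) t). rewrite (Hs n) in B2. rewrite <- tech_pow_Rmult in B2.
    replace (w t - volterra f p u v t)
      with (- (volterra f p (u_ n) (v_ n) t - w t)
        + (volterra f p (u_ n) (v_ n) t - volterra f p u v t)) by ring.
    eapply Rle_trans; [apply Rabs_triang |]. rewrite Rabs_Ropp. lra. }
  assert (Eu : forall t, u t = volterra f1 p1 u v t)
    by (apply (Hfix f1 p1 u u_ Lip1 Hu); intros n; apply picard_iterate_S).
  assert (Ev : forall t, v t = volterra f2 p2 u v t)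
    by (apply (Hfix f2 p2 v v_ Lip2 Hv); intros n; apply picard_iterate_S).
  assert (Hh := picard_step_pos).
  assert (V0 : forall f p, volterra f p u v 0 = p).
  { intros f p. unfold volterra. rewrite clamp_id by lra.
    rewrite RInt_point. apply Rplus_0_r. }
  assert (Hder : forall f p w,
    (forall x y x' y', Rabs (f x y - f x' y') <= L * (Rabs (x - x') + Rabs (y - y'))) ->
    (forall t, w t = volterra f p u v t) ->
    forall t, - h < t < h -> is_derive w t (f (u t) (v t))).
  { intros f p w Hf Ew t Ht.
    apply is_derive_ext_loc with (fun s => p + RInt (fun s => f (u s) (v s)) 0 s).
    - assert (Hd : 0 < Rmin (t + h) (h - t)) by (apply Rmin_case; lra).
      exists (mkposreal _ Hd). intros s Hs.
      change (Rabs (s - t) < Rmin (t + h) (h - t)) in Hs. apply Rabs_def2 in Hs.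
      assert (M1 := Rmin_l (t + h) (h - t)). assert (M2 := Rmin_r (t + h) (h - t)).
      rewrite Ew. unfold volterra. rewrite clamp_id; [reflexivity | lra].
    - rewrite <- (Rplus_0_l (f (u t) (v t))).
      apply (is_derive_plus (fun _ => p) (fun s => RInt _ 0 s)).
      + apply (is_derive_const (V := R_NormedModule)).
      + apply (RInt_continuity_is_derive (fun s => f (u s) (v s))). intros s. now apply (lipschitz_continuity_pt f L). }
  exists h, u, v. split; [exact Hh |].
  split; [now rewrite Eu |]. split; [now rewrite Ev |].
  split; [exact Cu |]. split; [exact Cv |].
  intros t Ht. split; [now apply (Hder f1 p1) | now apply (Hder f2 p2)].
Qed.

End Picard.

Lemma interior_square (p : R * R) :
  fst p ^ 2 + snd p ^ 2 < 1 ->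
  exists r, 0 < r /\ forall x y,
    fst p - r <= x <= fst p + r -> snd p - r <= y <= snd p + r -> disk (x, y).
Proof.
  intros Hp.
  assert (C : continuity_2d_pt (fun u v => u * u + v * v) (fst p) (snd p)).
  { apply continuity_2d_pt_plus; apply continuity_2d_pt_mult;
      (apply continuity_2d_pt_id1 || apply continuity_2d_pt_id2). }
  assert (He : 0 < 1 - (fst p ^ 2 + snd p ^ 2)) by lra.
  destruct (C (mkposreal _ He)) as [d Hd]. simpl in Hd. assert (Hd0 := cond_pos d).
  exists (d / 2). split; [lra |]. intros x y Hx Hy. unfold disk; simpl.
  assert (K := Hd x y ltac:(apply Rabs_def1; lra) ltac:(apply Rabs_def1; lra)).
  apply Rabs_def2 in K. lra.
Qed.

(** The field is controlled only on the disk. Clamping both coordinates to a small square inside the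
    disk yields a globally Lipschitz system; for short times its solution stays in the square, where
    clamping does nothing. An interior point is required since the field may point outwards at the
    circle. *)
Lemma curve_exists (X : vector_field) (L : R) (p : R * R) :
  lipschitz_field X L -> fst p ^ 2 + snd p ^ 2 < 1 ->
  exists h gamma, 0 < h /\ gamma 0 = p /\ curve X (fun t => - h < t < h) gamma.
Proof.
  intros [(HL & _ & L1) (_ & _ & L2)] Hp.
  destruct (interior_square p Hp) as (r & Hr & Hin).
  set (c1 := clamp (fst p - r) (fst p + r)). set (c2 := clamp (snd p - r) (snd p + r)).
  assert (Hdisk : forall x y, disk (c1 x, c2 y)) by (intros; apply Hin; apply clamp_in; lra).
  assert (Hlip : forall f, (forall p q, disk p -> disk q -> Rabs (f p - f q) <= L * dist1 p q) ->
    forall x y x' y', Rabs (f (c1 x, c2 y) - f (c1 x', c2 y'))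
      <= L * (Rabs (x - x') + Rabs (y - y'))).
  { intros f Hf x y x' y'. eapply Rle_trans; [now apply Hf |].
    apply Rmult_le_compat_l; [lra |]. unfold dist1; simpl.
    apply Rplus_le_compat; apply clamp_lipschitz. }
  destruct (picard (fun x y => fst (X (c1 x, c2 y))) (fun x y => snd (X (c1 x, c2 y)))
    L (fst p) (snd p) HL (Hlip (fun p => fst (X p)) L1) (Hlip (fun p => snd (X p)) L2))
    as (h & u & v & Hh & Eu & Ev & Cu & Cv & Hd).
  destruct (continuity_pt_eps_inv u 0 r (Cu 0) Hr) as (d1 & Hd1 & K1).
  destruct (continuity_pt_eps_inv v 0 r (Cv 0) Hr) as (d2 & Hd2 & K2).
  exists (Rmin h (Rmin d1 d2)), (fun t => (u t, v t)).
  split; [repeat apply Rmin_case; assumption |].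
  split; [rewrite Eu, Ev; now rewrite <- surjective_pairing |].
  intros t Ht.
  assert (M1 := Rmin_l h (Rmin d1 d2)). assert (M2 := Rmin_r h (Rmin d1 d2)).
  assert (M3 := Rmin_l d1 d2). assert (M4 := Rmin_r d1 d2).
  specialize (K1 t ltac:(apply Rabs_def1; lra)). specialize (K2 t ltac:(apply Rabs_def1; lra)).
  rewrite Eu in K1. rewrite Ev in K2. apply Rabs_def2 in K1, K2.
  destruct (Hd t) as [D1 D2]; [lra |].
  unfold c1, c2 in D1, D2. rewrite !clamp_id in D1, D2 by lra.
  split; [apply Hin; lra |].
  split; intros eps He.
  - destruct (is_derive_eps_inv _ _ _ D1 eps He) as (d & Hd' & K).
    exists d. split; [exact Hd' |]. intros s _. now apply K.
  - destruct (is_derive_eps_inv _ _ _ D2 eps He) as (d & Hd' & K).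
    exists d. split; [exact Hd' |]. intros s _. now apply K.
Qed.

(** * Parallelism of the two fields *)

Definition cross (v w : R * R) : R := fst v * snd w - snd v * fst w.

Lemma curve_is_derive (X : vector_field) (gamma : R -> R * R) (t : R) :
  curve X (fun _ => True) gamma ->
  is_derive (fun s => fst (gamma s)) t (fst (X (gamma t))) /\
  is_derive (fun s => snd (gamma s)) t (snd (X (gamma t))).
Proof.
  intros H. destruct (H t I) as (_ & H1 & H2).
  split; apply is_derive_eps; intros eps He;
    [destruct (H1 eps He) as (d & Hd & K) | destruct (H2 eps He) as (d & Hd & K)];
    exists d; split; trivial; intros s; now apply K.
Qed.

Lemma periodic_IZR (gamma : R -> R * R) (T : R) (k : Z) (t : R) :
  (forall s, gamma (s + T) = gamma s) -> gamma (t + IZR k * T) = gamma t.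
Proof.
  intros HT.
  assert (HN : forall n s, gamma (s + INR n * T) = gamma s).
  { induction n as [|n IH]; intros s.
    - simpl. now rewrite Rmult_0_l, Rplus_0_r.
    - rewrite S_INR. replace (s + (INR n + 1) * T) with (s + INR n * T + T) by ring.
      now rewrite HT. }
  destruct (Z_le_gt_dec 0 k) as [Hk | Hk].
  - rewrite <- (Z2Nat.id k Hk), <- INR_IZR_INZ. apply HN.
  - rewrite <- (HN (Z.to_nat (- k)) (t + IZR k * T)).
    rewrite INR_IZR_INZ, Z2Nat.id, opp_IZR by lia. f_equal. ring.
Qed.

Lemma periodic_representative (gamma : R -> R * R) (T t : R) :
  0 < T -> (forall s, gamma (s + T) = gamma s) ->
  exists s, 0 <= s < T /\ gamma s = gamma t.
Proof.
  intros HT Hp. exists (t + IZR (- Int_part (t / T)) * T).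
  split; [| now apply periodic_IZR].
  destruct (base_Int_part (t / T)) as [B1 B2].
  assert (E : t = t / T * T) by (field; lra).
  rewrite opp_IZR. set (n := IZR (Int_part (t / T))) in *. set (q := t / T) in *.
  rewrite E. split; nra.
Qed.

(** On the compact set of times [e, T - e] the curve keeps a positive distance from its starting
    point. A point closer than that is therefore reached at a time near 0 or near T modulo T. *)
Lemma minimal_period_return (X : vector_field) (L T : R) (gamma : R -> R * R) (eps : R) :
  lipschitz_field X L -> curve X (fun _ => True) gamma -> 0 < T ->
  (forall t, gamma (t + T) = gamma t) ->
  (forall S, 0 < S -> (forall t, gamma (t + S) = gamma t) -> T <= S) ->
  0 < eps ->
  exists delta, 0 < delta /\ forall t, dist1 (gamma t) (gamma 0) < delta ->
    exists s, Rabs s < eps /\ gamma s = gamma t.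
Proof.
  intros HL Hg HT Hp Hmin He.
  set (e := Rmin eps (T / 2)).
  assert (e1 : e <= eps) by apply Rmin_l. assert (e2 : e <= T / 2) by apply Rmin_r.
  assert (e0 : 0 < e) by (unfold e; apply Rmin_case; lra).
  destruct (continuity_ab_min (fun t => dist1 (gamma t) (gamma 0)) e (T - e)) as (m & Hm & Im);
    [lra | |].
  { intros t _. destruct (curve_is_derive X gamma t Hg) as [D1 D2].
    apply is_derive_continuity_pt in D1, D2.
    apply continuity_pt_plus; apply (continuity_pt_comp _ Rabs);
      try apply Rcontinuity_abs; apply continuity_pt_minus; trivial;
      now apply continuity_pt_const. }
  assert (Hpos : 0 < dist1 (gamma m) (gamma 0)).
  { destruct (dist1_pos (gamma m) (gamma 0)) as [H | H]; [exact H | exfalso].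
    assert (E : gamma m = gamma 0).
    { unfold dist1 in H.
      assert (A1 := Rabs_pos (fst (gamma m) - fst (gamma 0))).
      assert (A2 := Rabs_pos (snd (gamma m) - snd (gamma 0))).
      assert (Z1 : Rabs (fst (gamma m) - fst (gamma 0)) = 0) by lra.
      assert (Z2 : Rabs (snd (gamma m) - snd (gamma 0)) = 0) by lra.
      apply Rabs_eq_0 in Z1, Z2.
      rewrite (surjective_pairing (gamma m)), (surjective_pairing (gamma 0)). f_equal; lra. }
    (* By uniqueness a single return to the starting point makes [m] a period, and m < T contradicts
       minimality. *)
    assert (Hm' : forall t, gamma (t + m) = gamma t).
    { intros t. apply (curve_unique X L (fun _ => True) (fun s => gamma (s + m)) gamma); trivial.
      - intros ? ? ? _ _ _. exact I.
      - apply (curve_shift X (fun _ => True) gamma m Hg).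
      - now rewrite Rplus_0_l. }
    specialize (Hmin m ltac:(lra) Hm'). lra. }
  exists (dist1 (gamma m) (gamma 0)). split; [exact Hpos |]. intros t Ht.
  destruct (periodic_representative gamma T t HT Hp) as (s & Hs & Es).
  destruct (Rlt_dec s e) as [A | A].
  - exists s. split; [apply Rabs_def1; lra | exact Es].
  - destruct (Rlt_dec (T - e) s) as [B | B].
    + exists (s - T). split; [apply Rabs_def1; lra |].
      rewrite <- (Hp (s - T)). now replace (s - T + T) with s by ring.
    + exfalso. specialize (Hm s ltac:(lra)). rewrite Es in Hm. lra.
Qed.

(* Both curves are differentiable at 0, so s F'(p) - tau F(p) = o(s + |tau|)
   for points gamma(tau) = beta(s) tending to p. *)
Lemma cross_zero_of_common_points (v w : R * R) (beta gamma : R -> R * R) (J : R -> Prop) (h : R) :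
  0 < h -> (forall s, 0 < s < h -> J s) ->
  derivative_within J (fun s => fst (beta s)) 0 (fst v) ->
  derivative_within J (fun s => snd (beta s)) 0 (snd v) ->
  derivative_within (fun _ => True) (fun s => fst (gamma s)) 0 (fst w) ->
  derivative_within (fun _ => True) (fun s => snd (gamma s)) 0 (snd w) ->
  beta 0 = gamma 0 ->
  (forall eps, 0 < eps -> exists delta, 0 < delta /\
    forall s, 0 < s < h -> dist1 (beta s) (gamma 0) < delta ->
      exists tau, Rabs tau < eps /\ gamma tau = beta s) ->
  cross v w = 0.
Proof.
  intros Hh HI B1 B2 G1 G2 E0 Hret. apply NNPP. intros Hc.
  set (c := cross v w) in *.
  assert (Hcp : 0 < Rabs c) by now apply Rabs_pos_lt.
  set (M := Rabs (fst v) + Rabs (snd v) + Rabs (fst w) + Rabs (snd w) + 1).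
  assert (P1 := Rabs_pos (fst v)). assert (P2 := Rabs_pos (snd v)).
  assert (P3 := Rabs_pos (fst w)). assert (P4 := Rabs_pos (snd w)).
  assert (HM : 0 < M) by (unfold M; lra).
  (* Chosen so that the last estimate reads |c| (s + |tau|) <= (|c|/2)(s + |tau|), which is absurd
     for s > 0. *)
  set (eta := Rabs c / (2 * M)).
  assert (Heta : 0 < eta) by (apply Rdiv_lt_0_compat; lra).
  assert (EM : eta * M = Rabs c / 2) by (unfold eta; field; lra).
  destruct (G1 eta Heta) as (d1 & Hd1 & K1). destruct (G2 eta Heta) as (d2 & Hd2 & K2).
  destruct (Hret (Rmin d1 d2)) as (delta & Hdelta & Hr); [now apply Rmin_case |].
  assert (M1 := Rmin_l d1 d2). assert (M2 := Rmin_r d1 d2).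
  destruct (B1 eta Heta) as (d3 & Hd3 & K3). destruct (B2 eta Heta) as (d4 & Hd4 & K4).
  (* Since [dist1 (beta s) (gamma 0)] is at most s (M + 2 eta), taking s < q brings it below
     [delta]. *)
  set (q := delta / (M + 2 * eta)).
  assert (Hq : 0 < q) by (apply Rdiv_lt_0_compat; lra).
  set (s := Rmin (Rmin h q) (Rmin d3 d4) / 2).
  assert (S1 := Rmin_l (Rmin h q) (Rmin d3 d4)). assert (S2 := Rmin_r (Rmin h q) (Rmin d3 d4)).
  assert (S3 := Rmin_l h q). assert (S4 := Rmin_r h q).
  assert (S5 := Rmin_l d3 d4). assert (S6 := Rmin_r d3 d4).
  assert (Hs0 : 0 < s).
  { unfold s. apply Rdiv_lt_0_compat; [repeat apply Rmin_case; lra | lra]. }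
  assert (Hs : s < h /\ s < q /\ s < d3 /\ s < d4) by (unfold s in *; lra).
  assert (As : Rabs (s - 0) = s) by (rewrite Rminus_0_r; apply Rabs_pos_eq; lra).
  specialize (K3 s (HI s ltac:(lra)) ltac:(lra)). specialize (K4 s (HI s ltac:(lra)) ltac:(lra)).
  rewrite As in K3, K4. rewrite Rminus_0_r in K3, K4.
  rewrite E0 in K3, K4.
  set (x1 := fst (beta s) - fst (gamma 0)) in *. set (x2 := snd (beta s) - snd (gamma 0)) in *.
  destruct (Hr s ltac:(lra)) as (tau & Htau & Etau).
  { unfold dist1. fold x1 x2.
    assert (T1 := Rabs_triang (x1 - s * fst v) (s * fst v)).
    assert (T2 := Rabs_triang (x2 - s * snd v) (s * snd v)).
    rewrite Rabs_mult, (Rabs_pos_eq s) in T1, T2 by lra.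
    replace (x1 - s * fst v + s * fst v) with x1 in T1 by ring.
    replace (x2 - s * snd v + s * snd v) with x2 in T2 by ring.
    apply Rle_lt_trans with (s * (M + 2 * eta)).
    - unfold M. assert (0 <= s * Rabs (fst w)) by (apply Rmult_le_pos; lra).
      assert (0 <= s * Rabs (snd w)) by (apply Rmult_le_pos; lra). lra.
    - apply Rlt_le_trans with (q * (M + 2 * eta)).
      + apply Rmult_lt_compat_r; lra.
      + apply Req_le. unfold q. field. lra. }
  specialize (K1 tau I ltac:(rewrite Rminus_0_r; lra)).
  specialize (K2 tau I ltac:(rewrite Rminus_0_r; lra)).
  rewrite Rminus_0_r in K1, K2. rewrite Etau in K1, K2. fold x1 in K1. fold x2 in K2.
  set (y1 := s * fst v - tau * fst w). set (y2 := s * snd v - tau * snd w).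
  assert (Y1 : Rabs y1 <= eta * (s + Rabs tau)).
  { replace y1 with (- (x1 - s * fst v) + (x1 - tau * fst w)) by (unfold y1; ring).
    eapply Rle_trans; [apply Rabs_triang |]. rewrite Rabs_Ropp. lra. }
  assert (Y2 : Rabs y2 <= eta * (s + Rabs tau)).
  { replace y2 with (- (x2 - s * snd v) + (x2 - tau * snd w)) by (unfold y2; ring).
    eapply Rle_trans; [apply Rabs_triang |]. rewrite Rabs_Ropp. lra. }
  assert (Hb : forall z1 z2, Rabs (y1 * z2 - y2 * z1) <= eta * (s + Rabs tau) * (Rabs z1 + Rabs z2)).
  { intros z1 z2. unfold Rminus. eapply Rle_trans; [apply Rabs_triang |].
    rewrite Rabs_Ropp, !Rabs_mult.
    assert (Z1 : Rabs y1 * Rabs z2 <= eta * (s + Rabs tau) * Rabs z2)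
      by (apply Rmult_le_compat_r; [apply Rabs_pos | exact Y1]).
    assert (Z2 : Rabs y2 * Rabs z1 <= eta * (s + Rabs tau) * Rabs z1)
      by (apply Rmult_le_compat_r; [apply Rabs_pos | exact Y2]).
    lra. }
  (* The cross product of y = s v - tau w with w is s c, and with v it is tau c; adding both bounds
     controls s + |tau|. *)
  assert (C1 := Hb (fst w) (snd w)). assert (C2 := Hb (fst v) (snd v)).
  replace (y1 * snd w - y2 * fst w) with (s * c) in C1 by (unfold y1, y2, c, cross; ring).
  replace (y1 * snd v - y2 * fst v) with (tau * c) in C2 by (unfold y1, y2, c, cross; ring).
  rewrite Rabs_mult, (Rabs_pos_eq s) in C1 by lra. rewrite Rabs_mult in C2.
  assert (Ptau := Rabs_pos tau).
  assert (C3 : Rabs c * (s + Rabs tau) <= eta * M * (s + Rabs tau)).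
  { assert (0 <= eta * (s + Rabs tau)) by (apply Rmult_le_pos; lra). unfold M. lra. }
  rewrite EM in C3.
  assert (0 < Rabs c * (s + Rabs tau)) by (apply Rmult_lt_0_compat; lra). lra.
Qed.

Lemma origin_in_disk : disk origin.
Proof. unfold disk, origin; simpl. lra. Qed.

Lemma TC_complete_curve (F : vector_field) (q : R * R) :
  TC F -> disk q -> exists gamma, curve F (fun _ => True) gamma /\ gamma 0 = q.
Proof.
  intros (_ & _ & HZ & HC) Dq.
  destruct (classic (q = origin)) as [-> | Hq].
  - exists (fun _ => origin). split; [| reflexivity].
    intros t _. split; [exact Dq |].
    destruct (HZ origin Dq) as [_ Hz]. rewrite (Hz eq_refl).
    split; intros eps He; exists 1; (split; [lra |]); intros s _ _; simpl;
      rewrite Rmult_0_r, !Rminus_0_r, Rabs_R0;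
      apply Rmult_le_pos; [lra | apply Rabs_pos | lra | apply Rabs_pos].
  - destruct (HC q Dq Hq) as (gamma & T & [Hg H0] & _).
    exists gamma. split; [now apply integral_curve_curve | exact H0].
Qed.

Lemma orbit_on_complete_curve (F : vector_field) (L : R) (q z : R * R) (gamma : R -> R * R) :
  lipschitz_field F L -> curve F (fun _ => True) gamma -> gamma 0 = q ->
  orbit F q z -> exists t, gamma t = z.
Proof.
  intros HL Hg H0 (I & beta & t & HI & I0 & It & Hb & B0 & Bt).
  exists t. rewrite <- Bt. symmetry.
  apply (curve_unique F L I); trivial.
  - now apply integral_curve_curve.
  - now apply (curve_restrict F (fun _ => True)).
  - congruence.
Qed.

(** The orbit of F that contains the F'-orbit of p is given through some point q; since it passes
    through p, it is a time shift of the periodic curve through p. Common points of the two curves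
    then force parallel velocities. *)
Lemma cross_zero_interior (F F' : vector_field) (L L' : R) (p : R * R) (T : R) :
  TC F -> lipschitz_field F L -> lipschitz_field F' L' ->
  fst p ^ 2 + snd p ^ 2 < 1 -> is_period F p T ->
  (exists q, disk q /\ forall z, orbit F' p z -> orbit F q z) ->
  cross (F' p) (F p) = 0.
Proof.
  intros HF HL HL' Hp (gamma & [Hg G0] & HT & Hper & Hmin) (q & Dq & Hq).
  apply integral_curve_curve in Hg.
  destruct (curve_exists F' L' p HL' Hp) as (h & beta & Hh & B0 & Hb).
  assert (Horb : forall s, - h < s < h -> orbit F' p (beta s)).
  { intros s Hs. exists (fun t => - h < t < h), beta, s.
    split; [intros a b t Ha Hb' Ht; lra |].
    split; [lra |]. split; [exact Hs |].
    split; [now apply curve_integral_curve |]. now split. }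
  destruct (TC_complete_curve F q HF Dq) as (delta & Hd & D0).
  destruct (orbit_on_complete_curve F L q p delta HL Hd D0) as [t0 Ht0].
  { apply Hq. rewrite <- B0 at 2. apply Horb. lra. }
  (* [delta] passes through p at time [t0], so by uniqueness its shift by [t0] is [gamma]; points of
     [beta] found on [delta] thus lie on [gamma]. *)
  assert (Hsub : forall s, - h < s < h -> exists t, gamma t = beta s).
  { intros s Hs.
    destruct (orbit_on_complete_curve F L q (beta s) delta HL Hd D0) as [t Ht];
      [now apply Hq, Horb |].
    exists (t - t0). rewrite <- Ht.
    replace (delta t) with (delta (t - t0 + t0)) by (f_equal; ring).
    apply (curve_unique F L (fun _ => True) gamma (fun s => delta (s + t0))); trivial.
    - intros ? ? ? _ _ _. exact I.
    - apply (curve_shift F (fun _ => True) delta t0 Hd).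
    - rewrite Rplus_0_l. congruence. }
  destruct (Hb 0) as (_ & D1 & D2); [lra |]. destruct (Hg 0 I) as (_ & D3 & D4).
  rewrite B0 in D1, D2. rewrite G0 in D3, D4.
  apply (cross_zero_of_common_points _ _ beta gamma (fun t => - h < t < h) h); trivial.
  - intros s Hs. lra.
  - congruence.
  - intros eps He.
    destruct (minimal_period_return F L T gamma eps HL Hg HT Hper Hmin He) as (d & Hd0 & K).
    exists d. split; [exact Hd0 |]. intros s Hs Hdist.
    destruct (Hsub s) as [t Ht]; [lra |]. rewrite <- Ht in Hdist.
    destruct (K t Hdist) as (tau & Htau & E). exists tau. split; [exact Htau | congruence].
Qed.

Lemma cross_lipschitz (X Y : vector_field) (L L' : R) (p q : R * R) :
  lipschitz_field X L -> lipschitz_field Y L' -> disk p -> disk q ->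
  Rabs (cross (X p) (Y p) - cross (X q) (Y q)) <= 4 * L * L' * dist1 p q.
Proof.
  intros [(HL & B1 & L1) (_ & B2 & L2)] [(HL' & B1' & L1') (_ & B2' & L2')] Dp Dq.
  assert (Hmul : forall a b a' b', Rabs b <= L' -> Rabs a' <= L ->
    Rabs (a - a') <= L * dist1 p q -> Rabs (b - b') <= L' * dist1 p q ->
    Rabs (a * b - a' * b') <= 2 * L * L' * dist1 p q).
  { intros a b a' b' Hb Ha' Hab Hbb.
    assert (P := dist1_pos p q).
    replace (a * b - a' * b') with ((a - a') * b + a' * (b - b')) by ring.
    eapply Rle_trans; [apply Rabs_triang |]. rewrite !Rabs_mult.
    assert (Z1 : Rabs (a - a') * Rabs b <= L * dist1 p q * L')
      by (apply Rmult_le_compat; trivial; apply Rabs_pos).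
    assert (Z2 : Rabs a' * Rabs (b - b') <= L * (L' * dist1 p q))
      by (apply Rmult_le_compat; trivial; apply Rabs_pos).
    lra. }
  unfold cross.
  replace (fst (X p) * snd (Y p) - snd (X p) * fst (Y p) - (fst (X q) * snd (Y q) - snd (X q) * fst (Y q)))
    with ((fst (X p) * snd (Y p) - fst (X q) * snd (Y q))
      + - (snd (X p) * fst (Y p) - snd (X q) * fst (Y q))) by ring.
  eapply Rle_trans; [apply Rabs_triang |]. rewrite Rabs_Ropp.
  assert (Z1 := Hmul _ _ _ _ (B2' p Dp) (B1 q Dq) (L1 p q Dp Dq) (L2' p q Dp Dq)).
  assert (Z2 := Hmul _ _ _ _ (B1' p Dp) (B2 q Dq) (L2 p q Dp Dq) (L1' p q Dp Dq)).
  cbv beta in Z1, Z2. lra.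
Qed.

(** Each p is approached by the interior points (1 - s) p with s = 2^-n, at [dist1] at most 2s. The
    cross product vanishes there and is Lipschitz on the disk, so it vanishes at p. *)
Lemma cross_zero_on_disk (F F' : vector_field) :
  PTC F -> smooth_vector_field F' ->
  (forall p, disk p -> exists q, disk q /\ forall z, orbit F' p z -> orbit F q z) ->
  forall p, disk p -> cross (F' p) (F p) = 0.
Proof.
  intros [HF (theta & _ & Hth)] HF' Horb.
  destruct (smooth_lipschitz_field F) as [L HL]; [apply HF |].
  destruct (smooth_lipschitz_field F' HF') as [L' HL'].
  assert (Hint : forall p, fst p ^ 2 + snd p ^ 2 < 1 -> cross (F' p) (F p) = 0).
  { intros p Hp. assert (Dp : disk p) by (unfold disk; lra).
    destruct (classic (p = origin)) as [-> | Hne].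
    - assert (Z : F origin = (0, 0)) by now apply HF.
      rewrite Z. unfold cross; simpl. ring.
    - apply (cross_zero_interior F F' L L' p (theta p)); trivial.
      + now apply Hth.
      + now apply Horb. }
  intros p Dp.
  enough (H : Rabs (cross (F' p) (F p)) <= 0).
  { assert (P := Rabs_pos (cross (F' p) (F p))). apply Rabs_eq_0. lra. }
  assert (HLp : 0 < L) by apply HL. assert (HLp' : 0 < L') by apply HL'.
  apply (le_0_of_le_pow_half _ (8 * L' * L)). intros n.
  assert (Hs := pow_half_pos n). set (s := (/ 2) ^ n) in *.
  assert (Hs1 : s <= 1).
  { unfold s. rewrite <- (pow1 n). apply pow_incr. lra. }
  set (q := ((1 - s) * fst p, (1 - s) * snd p)).
  assert (Hq : fst q ^ 2 + snd q ^ 2 < 1).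
  { unfold q; simpl. unfold disk in Dp.
    replace ((1 - s) * fst p * ((1 - s) * fst p * 1) + (1 - s) * snd p * ((1 - s) * snd p * 1))
      with ((1 - s) ^ 2 * (fst p ^ 2 + snd p ^ 2)) by ring.
    assert (A1 := pow2_ge_0 (fst p)). assert (A2 := pow2_ge_0 (snd p)). nra. }
  assert (Dq : disk q) by (unfold disk; lra).
  assert (K := cross_lipschitz F' F L' L p q HL' HL Dp Dq).
  rewrite (Hint q Hq), Rminus_0_r in K.
  eapply Rle_trans; [exact K |].
  assert (Hdist : dist1 p q <= 2 * s).
  { destruct (disk_bounds p Dp) as [A1 A2]. unfold dist1, q; simpl.
    replace (fst p - (1 - s) * fst p) with (s * fst p) by ring.
    replace (snd p - (1 - s) * snd p) with (s * snd p) by ring.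
    rewrite !Rabs_mult, (Rabs_pos_eq s) by lra.
    assert (X1 : Rabs (fst p) <= 1) by (apply Rabs_le; lra).
    assert (X2 : Rabs (snd p) <= 1) by (apply Rabs_le; lra). nra. }
  assert (0 < 4 * L' * L) by (apply Rmult_lt_0_compat; lra).
  replace (8 * L' * L * s) with (4 * L' * L * (2 * s)) by ring.
  apply Rmult_le_compat_l; lra.
Qed.

(** * Invertibility of the linear part at the origin *)

Lemma exp_nondecreasing (x y : R) : x <= y -> exp x <= exp y.
Proof. intros [H | ->]; [left; now apply exp_increasing | apply Rle_refl]. Qed.

Lemma smooth_on_is_derive_comp (U : R -> R -> Prop) (g : R -> R -> R) (x y : R -> R) (t x' y' : R) :
  open_2d U -> smooth_on U g -> U (x t) (y t) -> is_derive x t x' -> is_derive y t y' ->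
  is_derive (fun s => g (x s) (y s)) t
    (pderive_x g (x t) (y t) * x' + pderive_y g (x t) (y t) * y').
Proof.
  intros HU Hg Ht Hx Hy.
  apply is_derive_Reals. apply is_derive_Reals in Hx, Hy.
  apply derivable_pt_lim_comp_2d; trivial.
  apply filterdiff_differentiable_pt_lim.
  apply (is_derive_filterdiff g (x t) (y t) (pderive_x g)).
  - destruct (HU _ _ Ht) as [d Hd]. exists d.
    intros [u v] [Hu Hv]. apply (smooth_on_is_derive_x U); [exact Hg | now apply Hd].
  - now apply (smooth_on_is_derive_y U).
  - apply continuity_2d_pt_filterlim. apply (smooth_on_continuity U); [| exact Ht].
    now apply smooth_on_pderive_x.
Qed.

Lemma abs_linear_form_le (a b p q C : R) :
  Rabs a <= C -> Rabs b <= C -> Rabs (a * p + b * q) <= C * (Rabs p + Rabs q).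
Proof.
  intros Ha Hb. eapply Rle_trans; [apply Rabs_triang |]. rewrite !Rabs_mult.
  assert (Hp := Rabs_pos p). assert (Hq := Rabs_pos q). nra.
Qed.

(** Bound on the derivative of p^2 + q^2, in the form Gronwall requires. With S = |p| + |q|, the
    mixed term e S N is split by 2 S N <= S^2 + N^2, leaving a forcing term in N^2 alone. *)
Lemma perturbed_quadratic_bound (p q u v k e N : R) :
  0 <= k -> 0 <= e <= 1 -> 0 <= N ->
  Rabs u <= k * (Rabs p + Rabs q) + 2 * e * N ->
  Rabs v <= k * (Rabs p + Rabs q) + 2 * e * N ->
  2 * p * u + 2 * q * v <= (4 * k + 4) * (p ^ 2 + q ^ 2) + 2 * e * N ^ 2.
Proof.
  intros Hk He HN Hu Hv.
  assert (Hp := Rabs_pos p). assert (Hq := Rabs_pos q).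
  rewrite <- (pow2_abs p), <- (pow2_abs q).
  set (S := Rabs p + Rabs q) in *.
  assert (B : 2 * p * u + 2 * q * v <= 2 * S * (k * S + 2 * e * N)).
  { assert (B1 : p * u <= Rabs p * (k * S + 2 * e * N)).
    { eapply Rle_trans; [apply Rle_abs |]. rewrite Rabs_mult. now apply Rmult_le_compat_l. }
    assert (B2 : q * v <= Rabs q * (k * S + 2 * e * N)).
    { eapply Rle_trans; [apply Rle_abs |]. rewrite Rabs_mult. now apply Rmult_le_compat_l. }
    unfold S in *. lra. }
  assert (HS : S ^ 2 <= 2 * (Rabs p ^ 2 + Rabs q ^ 2)).
  { unfold S. assert (0 <= (Rabs p - Rabs q) ^ 2) by apply pow2_ge_0. lra. }
  assert (A1 : k * S ^ 2 <= k * (2 * (Rabs p ^ 2 + Rabs q ^ 2))) by now apply Rmult_le_compat_l.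
  assert (A2 : e * (2 * S * N) <= e * (S ^ 2 + N ^ 2)).
  { apply Rmult_le_compat_l; [lra |]. assert (0 <= (S - N) ^ 2) by apply pow2_ge_0. lra. }
  assert (A3 : e * S ^ 2 <= 1 * S ^ 2) by (apply Rmult_le_compat_r; [apply pow2_ge_0 | lra]).
  lra.
Qed.

(* [exp(-m t) (P, Q) - (P 0, Q 0)] satisfies a linear equation with forcing term of
   size [eps], so by Gronwall it stays small and [(P, Q)] never turns by 90 degrees. *)
Lemma almost_eigenvector_advance
    (a b c d m M T eps : R) (x y P Q e11 e12 e21 e22 : R -> R) :
  let k := Rabs a + Rabs b + Rabs c + Rabs d + Rabs m + 1 in
  0 < T <= M -> eps = exp (- ((4 * k + 4) * M)) / 8 ->
  (forall t, 0 <= t <= T -> is_derive x t (P t)) ->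
  (forall t, 0 <= t <= T -> is_derive y t (Q t)) ->
  (forall t, 0 <= t <= T -> is_derive P t (e11 t * P t + e12 t * Q t)) ->
  (forall t, 0 <= t <= T -> is_derive Q t (e21 t * P t + e22 t * Q t)) ->
  (forall t, 0 <= t <= T -> Rabs (e11 t - a) <= eps /\ Rabs (e12 t - b) <= eps /\
    Rabs (e21 t - c) <= eps /\ Rabs (e22 t - d) <= eps) ->
  let N := Rabs (P 0) + Rabs (Q 0) in
  0 < N ->
  Rabs ((a - m) * P 0 + b * Q 0) <= eps * N ->
  Rabs (c * P 0 + (d - m) * Q 0) <= eps * N ->
  P 0 * x 0 + Q 0 * y 0 < P 0 * x T + Q 0 * y T.
Proof.
  intros k HT Eeps Hx Hy HP HQ He N HN Hv1 Hv2.
  assert (Pa := Rabs_pos a). assert (Pb := Rabs_pos b). assert (Pc := Rabs_pos c).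
  assert (Pd := Rabs_pos d). assert (Pm := Rabs_pos m).
  assert (Hk : 1 <= k) by (unfold k; lra).
  set (K := 4 * k + 4) in *.
  assert (Hexp := exp_pos (- (K * M))).
  assert (Heps : 0 < eps <= 1).
  { split; [lra |]. assert (exp (- (K * M)) <= exp 0).
    { apply exp_nondecreasing. assert (0 < K * M) by (apply Rmult_lt_0_compat; unfold K; lra). lra. }
    rewrite exp_0 in H. lra. }
  set (D1 := fun t => exp (- m * t) * P t - P 0).
  set (D2 := fun t => exp (- m * t) * Q t - Q 0).
  set (D1' := fun t => exp (- m * t) * ((e11 t - m) * P t + e12 t * Q t)).
  set (D2' := fun t => exp (- m * t) * (e21 t * P t + (e22 t - m) * Q t)).
  assert (HD1 : forall t, 0 <= t <= T -> is_derive D1 t (D1' t)).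
  { intros t Ht. assert (X := HP t Ht). unfold D1, D1'.
    auto_derive; [now eexists; exact X |].
    change (Derive (fun s : R => P s) t) with (Derive P t).
    rewrite (is_derive_unique _ _ _ X). ring. }
  assert (HD2 : forall t, 0 <= t <= T -> is_derive D2 t (D2' t)).
  { intros t Ht. assert (X := HQ t Ht). unfold D2, D2'.
    auto_derive; [now eexists; exact X |].
    change (Derive (fun s : R => Q s) t) with (Derive Q t).
    rewrite (is_derive_unique _ _ _ X). ring. }
  assert (Hsh : forall z w B, Rabs (z - w) <= B -> Rabs z <= Rabs w + B).
  { intros z w B Hz. assert (X := Rabs_triang (z - w) w).
    replace (z - w + w) with z in X by ring. lra. }
  assert (Hshm : forall z w B, Rabs (z - w) <= B -> Rabs (z - m) <= Rabs w + Rabs m + B).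
  { intros z w B Hz. apply Hsh in Hz. unfold Rminus.
    eapply Rle_trans; [apply Rabs_triang |]. rewrite Rabs_Ropp. lra. }
  assert (HB : forall t, 0 <= t <= T ->
    Rabs (D1' t) <= k * (Rabs (D1 t) + Rabs (D2 t)) + 2 * eps * N /\
    Rabs (D2' t) <= k * (Rabs (D1 t) + Rabs (D2 t)) + 2 * eps * N).
  { intros t Ht. destruct (He t Ht) as (E1 & E2 & E3 & E4).
    assert (F1 := Hshm _ _ _ E1). assert (F2 := Hsh _ _ _ E2).
    assert (F3 := Hsh _ _ _ E3). assert (F4 := Hshm _ _ _ E4).
    split.
    (* With E(t) the matrix of coefficients, A that of [a], [b], [c], [d], and G = (P, Q), the
       derivative of D splits as (E - m) D + (A - m) G(0) + (E - A) G(0). The last two terms are at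
       most eps N each: one by the almost-eigenvector hypothesis, the other by closeness of E to
       A. *)
    - replace (D1' t) with (((e11 t - m) * D1 t + e12 t * D2 t)
        + ((a - m) * P 0 + b * Q 0) + ((e11 t - a) * P 0 + (e12 t - b) * Q 0))
        by (unfold D1', D1, D2; ring).
      assert (B1 : Rabs ((e11 t - m) * D1 t + e12 t * D2 t) <= k * (Rabs (D1 t) + Rabs (D2 t)))
        by (apply abs_linear_form_le; unfold k; lra).
      assert (B2 := abs_linear_form_le _ _ (P 0) (Q 0) _ E1 E2). fold N in B2.
      eapply Rle_trans; [apply Rabs_triang |].
      assert (B3 := Rabs_triang ((e11 t - m) * D1 t + e12 t * D2 t) ((a - m) * P 0 + b * Q 0)).
      lra.
    - replace (D2' t) with ((e21 t * D1 t + (e22 t - m) * D2 t)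
        + (c * P 0 + (d - m) * Q 0) + ((e21 t - c) * P 0 + (e22 t - d) * Q 0))
        by (unfold D2', D1, D2; ring).
      assert (B1 : Rabs (e21 t * D1 t + (e22 t - m) * D2 t) <= k * (Rabs (D1 t) + Rabs (D2 t)))
        by (apply abs_linear_form_le; unfold k; lra).
      assert (B2 := abs_linear_form_le _ _ (P 0) (Q 0) _ E3 E4). fold N in B2.
      eapply Rle_trans; [apply Rabs_triang |].
      assert (B3 := Rabs_triang (e21 t * D1 t + (e22 t - m) * D2 t) (c * P 0 + (d - m) * Q 0)).
      lra. }
  assert (D10 : D1 0 = 0) by (unfold D1; rewrite Rmult_0_r, exp_0; ring).
  assert (D20 : D2 0 = 0) by (unfold D2; rewrite Rmult_0_r, exp_0; ring).
  assert (Hder : forall t, 0 <= t <= T -> is_derive (fun s => D1 s ^ 2 + D2 s ^ 2) t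
    (2 * D1 t * D1' t + 2 * D2 t * D2' t)).
  { intros t Ht. apply is_derive_sum_squares; [now apply HD1 | now apply HD2]. }
  (* Gronwall with K = 4k + 4 gives at most 2 eps N^2 exp(K M), which equals N^2/4 for the chosen
     [eps]; this is the origin of the divisor 8. *)
  assert (Hsmall : forall t, 0 <= t <= T -> D1 t ^ 2 + D2 t ^ 2 <= N ^ 2 / 4).
  { intros t Ht.
    assert (G := gronwall (fun s => D1 s ^ 2 + D2 s ^ 2)
      (fun s => 2 * D1 s * D1' s + 2 * D2 s * D2' s) 0 t K (2 * eps * N ^ 2)).
    cbv beta in G. rewrite D10, D20 in G.
    assert (HKp : 1 <= K) by (unfold K; lra).
    assert (G' : D1 t ^ 2 + D2 t ^ 2 + 2 * eps * N ^ 2 / K <=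
      (0 ^ 2 + 0 ^ 2 + 2 * eps * N ^ 2 / K) * exp (K * (t - 0))).
    { apply G; [lra | lra | | |].
      - intros s Hs. eapply is_derive_continuity_pt, Hder. lra.
      - intros s Hs. apply Hder. lra.
      - intros s Hs. destruct (HB s ltac:(lra)) as [H1 H2].
        apply perturbed_quadratic_bound; lra. }
    assert (HN2 : 0 < N ^ 2) by (apply pow_lt; exact HN).
    set (Z := 2 * eps * N ^ 2) in *.
    assert (HZ : 0 < Z) by (unfold Z; apply Rmult_lt_0_compat; lra).
    assert (HZK : 0 < Z / K <= Z).
    { split; [apply Rdiv_lt_0_compat; lra |].
      apply Rmult_le_reg_r with K; [lra |]. unfold Rdiv.
      rewrite Rmult_assoc, Rinv_l, Rmult_1_r by lra. nra. }
    assert (Hmono : exp (K * (t - 0)) <= exp (K * M)).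
    { apply exp_nondecreasing. apply Rmult_le_compat_l; lra. }
    assert (Hpos := exp_pos (K * (t - 0))).
    assert (Hfin : Z * exp (K * M) = N ^ 2 / 4).
    { unfold Z. rewrite Eeps. replace (2 * (exp (- (K * M)) / 8) * N ^ 2 * exp (K * M))
        with (exp (- (K * M)) * exp (K * M) * N ^ 2 / 4) by field.
      rewrite <- exp_plus. replace (- (K * M) + K * M) with 0 by ring.
      rewrite exp_0. field. }
    rewrite <- Hfin.
    apply Rle_trans with (Z / K * exp (K * (t - 0))); [lra |].
    apply Rmult_le_compat; lra. }
  (* The projection of the position on G(0) has derivative <G(0), G(t)>; its positivity is what
     remains. *)
  apply (increasing_of_derivative (fun t => P 0 * x t + Q 0 * y t)
    (fun t => P 0 * P t + Q 0 * Q t) 0 T).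
  - lra.
  - intros t Ht. apply continuity_pt_plus; apply continuity_pt_mult;
      try (now apply continuity_pt_const); eapply is_derive_continuity_pt;
      [now apply Hx | now apply Hy].
  - intros t Ht. apply (is_derive_plus (fun t => P 0 * x t) (fun t => Q 0 * y t));
      apply is_derive_scal; [apply Hx; lra | apply Hy; lra].
  - intros t Ht. assert (S := Hsmall t ltac:(lra)).
    assert (Hpos := exp_pos (- m * t)).
    assert (HN2 : N ^ 2 <= 2 * (P 0 ^ 2 + Q 0 ^ 2)).
    { rewrite <- (pow2_abs (P 0)), <- (pow2_abs (Q 0)). unfold N.
      assert (0 <= (Rabs (P 0) - Rabs (Q 0)) ^ 2) by apply pow2_ge_0. lra. }
    assert (HNp : 0 < N ^ 2) by (apply pow_lt; exact HN).
    (* Polarisation: |D|^2 <= N^2/4 <= |G(0)|^2/2 is less than |G(0)|^2, so the inner product must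
       be positive. *)
    assert (E : D1 t ^ 2 + D2 t ^ 2 = (exp (- m * t) * P t) ^ 2 + (exp (- m * t) * Q t) ^ 2
      + (P 0 ^ 2 + Q 0 ^ 2) - 2 * exp (- m * t) * (P 0 * P t + Q 0 * Q t))
      by (unfold D1, D2; ring).
    assert (A1 := pow2_ge_0 (exp (- m * t) * P t)). assert (A2 := pow2_ge_0 (exp (- m * t) * Q t)).
    assert (A3 : 0 < exp (- m * t) * (P 0 * P t + Q 0 * Q t)) by lra.
    apply Rmult_lt_reg_l with (exp (- m * t)); [exact Hpos | lra].
Qed.

(** Gronwall for |gamma|^2: as X vanishes at O, the Lipschitz bound controls X(z) by a multiple of
    |z|. It keeps an orbit starting close enough to O near O during a whole period. *)
Lemma curve_growth (X : vector_field) (L : R) (gamma : R -> R * R) (t : R) :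
  lipschitz_field X L -> X origin = (0, 0) -> curve X (fun _ => True) gamma -> 0 <= t ->
  fst (gamma t) ^ 2 + snd (gamma t) ^ 2
    <= (fst (gamma 0) ^ 2 + snd (gamma 0) ^ 2) * exp (4 * L * t).
Proof.
  intros [(HL & _ & L1) (_ & _ & L2)] H0 Hg Ht.
  assert (Hd : forall s, is_derive (fun s => fst (gamma s) ^ 2 + snd (gamma s) ^ 2) s
    (2 * fst (gamma s) * fst (X (gamma s)) + 2 * snd (gamma s) * snd (X (gamma s)))).
  { intros s. destruct (curve_is_derive X gamma s Hg). now apply is_derive_sum_squares. }
  assert (G := gronwall (fun s => fst (gamma s) ^ 2 + snd (gamma s) ^ 2) _ 0 t (4 * L) 0 Ht
    ltac:(lra) (fun s _ => is_derive_continuity_pt _ _ _ (Hd s)) (fun s _ => Hd s)).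
  cbv beta in G. unfold Rdiv in G.
  rewrite Rmult_0_l, !Rplus_0_r, Rminus_0_r in G. apply G.
  intros s _. destruct (Hg s I) as [Ds _].
  assert (Hb : forall f : R * R -> R, (forall p q, disk p -> disk q -> Rabs (f p - f q) <= L * dist1 p q) ->
    f origin = 0 -> Rabs (f (gamma s)) <= L * (Rabs (fst (gamma s)) + Rabs (snd (gamma s)))).
  { intros f Hf Hf0. specialize (Hf (gamma s) origin Ds origin_in_disk).
    rewrite Hf0 in Hf. unfold dist1, origin in Hf; simpl in Hf.
    now rewrite !Rminus_0_r in Hf. }
  assert (B1 := Hb (fun p => fst (X p)) L1 ltac:(cbv beta; now rewrite H0)).
  assert (B2 := Hb (fun p => snd (X p)) L2 ltac:(cbv beta; now rewrite H0)).
  assert (Q := quadratic_form_bound _ _ _ _ L HL B1 B2).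
  apply Rabs_le_between in Q. lra.
Qed.

(* The image of [A] consists of eigenvectors; when [A = 0] every direction is one. *)
Lemma almost_eigenvector_exists (r : R) (g1 g2 : R -> R -> R) (eps rho : R) :
  smooth_on (square r) g1 -> smooth_on (square r) g2 -> 0 < r -> 0 < eps -> 0 < rho ->
  g1 0 0 = 0 -> g2 0 0 = 0 ->
  let a := pderive_x g1 0 0 in let b := pderive_y g1 0 0 in
  let c := pderive_x g2 0 0 in let d := pderive_y g2 0 0 in
  let m := a + d in
  a * d - b * c = 0 ->
  exists x y, square rho x y /\ (x, y) <> origin /\
    let N := Rabs (g1 x y) + Rabs (g2 x y) in
    Rabs ((a - m) * g1 x y + b * g2 x y) <= eps * N /\
    Rabs (c * g1 x y + (d - m) * g2 x y) <= eps * N.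
Proof.
  intros Hg1 Hg2 Hr He Hrho Z1 Z2 a b c d m Hdet.
  (* u is a direction not killed by A; along the ray s u the field is s w + o(s), with w = A u
     nonzero. *)
  assert (Hdir : forall u1 u2, Rabs u1 <= 1 -> Rabs u2 <= 1 ->
    0 < Rabs (a * u1 + b * u2) + Rabs (c * u1 + d * u2) ->
    exists x y, square rho x y /\ (x, y) <> origin /\
      let N := Rabs (g1 x y) + Rabs (g2 x y) in
      Rabs ((a - m) * g1 x y + b * g2 x y) <= eps * N /\
      Rabs (c * g1 x y + (d - m) * g2 x y) <= eps * N).
  { intros u1 u2 Hu1 Hu2 HW.
    set (w1 := a * u1 + b * u2) in *. set (w2 := c * u1 + d * u2) in *.
    set (W := Rabs w1 + Rabs w2) in *.
    assert (H0 : square r (0 * u1) (0 * u2)) by (rewrite !Rmult_0_l; split; now rewrite Rabs_R0).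
    assert (Dl : forall u, is_derive (fun s => s * u) 0 u) by (intros u; auto_derive; [trivial | ring]).
    assert (D1 := smooth_on_is_derive_comp _ g1 _ _ 0 _ _ (open_square r) Hg1 H0 (Dl u1) (Dl u2)).
    assert (D2 := smooth_on_is_derive_comp _ g2 _ _ 0 _ _ (open_square r) Hg2 H0 (Dl u1) (Dl u2)).
    cbv beta in D1, D2. rewrite !Rmult_0_l in D1, D2. fold a b w1 in D1. fold c d w2 in D2.
    set (C := Rabs (a - m) + Rabs b + Rabs c + Rabs (d - m) + 1).
    assert (Pa := Rabs_pos (a - m)). assert (Pb := Rabs_pos b).
    assert (Pc := Rabs_pos c). assert (Pd := Rabs_pos (d - m)).
    (* The first bound gives N >= s W/2; the second makes the remainder, at most 2 C eta s, no
       larger than eps s W/2. *)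
    set (eta := Rmin (W / 4) (eps * W / (4 * C))).
    assert (HepsW : 0 < eps * W) by now apply Rmult_lt_0_compat.
    assert (Heta : 0 < eta).
    { unfold eta. apply Rmin_case; [lra | apply Rdiv_lt_0_compat; unfold C; lra]. }
    assert (Eta1 : eta <= W / 4) by apply Rmin_l.
    assert (Eta2 : C * (2 * eta) <= eps * (W / 2)).
    { assert (X : eta <= eps * W / (4 * C)) by apply Rmin_r.
      apply Rle_trans with (C * (2 * (eps * W / (4 * C)))).
      - apply Rmult_le_compat_l; [unfold C |]; lra.
      - apply Req_le. field. unfold C; lra. }
    destruct (is_derive_eps_inv _ _ _ D1 eta Heta) as (d1 & Hd1 & K1).
    destruct (is_derive_eps_inv _ _ _ D2 eta Heta) as (d2 & Hd2 & K2).
    set (s := Rmin rho (Rmin d1 d2) / 2).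
    assert (M1 := Rmin_l rho (Rmin d1 d2)). assert (M2 := Rmin_r rho (Rmin d1 d2)).
    assert (M3 := Rmin_l d1 d2). assert (M4 := Rmin_r d1 d2).
    assert (Hmin : 0 < Rmin rho (Rmin d1 d2)) by (repeat apply Rmin_case; lra).
    assert (Hs : 0 < s) by (unfold s; lra).
    assert (As : Rabs (s - 0) = s) by (rewrite Rminus_0_r; apply Rabs_pos_eq; lra).
    specialize (K1 s I ltac:(rewrite As; unfold s; lra)).
    specialize (K2 s I ltac:(rewrite As; unfold s; lra)).
    rewrite As, Rminus_0_r, !Rmult_0_l, Z1, Rminus_0_r in K1.
    rewrite As, Rminus_0_r, !Rmult_0_l, Z2, Rminus_0_r in K2.
    set (p := g1 (s * u1) (s * u2)) in *. set (q := g2 (s * u1) (s * u2)) in *.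
    assert (HN : s * (W / 2) <= Rabs p + Rabs q).
    { assert (T1 := Rabs_triang (s * w1 - p) p). assert (T2 := Rabs_triang (s * w2 - q) q).
      replace (s * w1 - p + p) with (s * w1) in T1 by ring.
      replace (s * w2 - q + q) with (s * w2) in T2 by ring.
      rewrite (Rabs_minus_sym (s * w1)) in T1. rewrite (Rabs_minus_sym (s * w2)) in T2.
      rewrite Rabs_mult, (Rabs_pos_eq s) in T1, T2 by lra.
      assert (eta * s <= W / 4 * s) by (apply Rmult_le_compat_r; lra).
      unfold W in *. lra. }
    assert (HNpos : 0 < s * (W / 2)) by (apply Rmult_lt_0_compat; lra).
    exists (s * u1), (s * u2). fold p q. split; [| split].
    - split; rewrite Rabs_mult, (Rabs_pos_eq s) by lra;
        apply Rle_lt_trans with (s * 1);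
        try (apply Rmult_le_compat_l; lra); unfold s; lra.
    - intros E. injection E as E1 E2. unfold p, q in HN. rewrite E1, E2, Z1, Z2, Rabs_R0 in HN. lra.
    (* The rows (z1, z2) of A - m kill w = A u, since (A - m) A = -det A = 0 by Cayley-Hamilton;
       only the o(s) remainder contributes. *)
    - assert (Hend : forall z1 z2, z1 * w1 + z2 * w2 = 0 -> Rabs z1 <= C -> Rabs z2 <= C ->
        Rabs (z1 * p + z2 * q) <= eps * (Rabs p + Rabs q)).
      { intros z1 z2 Hz HC1 HC2.
        replace (z1 * p + z2 * q) with (z1 * (p - s * w1) + z2 * (q - s * w2) + s * (z1 * w1 + z2 * w2)) by ring.
        rewrite Hz, Rmult_0_r, Rplus_0_r.
        eapply Rle_trans; [apply (abs_linear_form_le _ _ _ _ C); trivial |].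
        apply Rle_trans with (C * (2 * eta) * s).
        - rewrite Rmult_assoc. apply Rmult_le_compat_l; [unfold C |]; lra.
        - apply Rle_trans with (eps * (W / 2) * s); [apply Rmult_le_compat_r; lra |].
          rewrite Rmult_assoc. apply Rmult_le_compat_l; lra. }
      split; apply Hend; try (unfold C; lra).
      + unfold w1, w2, m. replace ((a - (a + d)) * (a * u1 + b * u2) + b * (c * u1 + d * u2))
          with (- (a * d - b * c) * u1) by ring. rewrite Hdet. ring.
      + unfold w1, w2, m. replace (c * (a * u1 + b * u2) + (d - (a + d)) * (c * u1 + d * u2))
          with (- (a * d - b * c) * u2) by ring. rewrite Hdet. ring. }
  destruct (Rlt_dec 0 (Rabs (a * 1 + b * 0) + Rabs (c * 1 + d * 0))) as [H | H].
  { apply (Hdir 1 0); trivial; rewrite ?Rabs_R1, ?Rabs_R0; lra. }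
  destruct (Rlt_dec 0 (Rabs (a * 0 + b * 1) + Rabs (c * 0 + d * 1))) as [H' | H'].
  { apply (Hdir 0 1); trivial; rewrite ?Rabs_R1, ?Rabs_R0; lra. }
  assert (Hz : a = 0 /\ b = 0 /\ c = 0 /\ d = 0).
  { rewrite !Rmult_0_r, !Rmult_1_r, !Rplus_0_r in H. rewrite !Rmult_0_r, !Rmult_1_r, !Rplus_0_l in H'.
    assert (Pa := Rabs_pos a). assert (Pb := Rabs_pos b).
    assert (Pc := Rabs_pos c). assert (Pd := Rabs_pos d).
    repeat split; apply Rabs_eq_0; lra. }
  destruct Hz as (Ea & Eb & Ec & Ed).
  (* Here both basis vectors are killed, so A = 0 and m = 0: both left sides vanish and any point
     other than O will do. *)
  exists (rho / 2), 0. split; [split; rewrite ?Rabs_R0, ?Rabs_pos_eq; lra |].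
  split; [intros E; injection E; lra |].
  unfold m. rewrite Ea, Eb, Ec, Ed.
  assert (P1 := Rabs_pos (g1 (rho / 2) 0)). assert (P2 := Rabs_pos (g2 (rho / 2) 0)).
  split; (match goal with |- Rabs ?z <= _ => replace z with 0 by ring end);
    rewrite Rabs_R0; apply Rmult_le_pos; lra.
Qed.

Lemma square_in_disk (r x y : R) : r <= / 2 -> square r x y -> disk (x, y).
Proof.
  intros Hr [Hx Hy]. unfold disk; simpl. apply Rabs_def2 in Hx, Hy.
  assert (x * (x * 1) <= / 2 * / 2) by nra. assert (y * (y * 1) <= / 2 * / 2) by nra. lra.
Qed.

(** If the determinant vanished, an almost eigenvector F(z) with z near O would make the projection
    of the orbit on F(z) strictly increase over one period, whereas the orbit returns to z. *)
Lemma PTC_nondegenerate (F : vector_field) (r : R) (g1 g2 : R -> R -> R) :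
  PTC F -> 0 < r <= / 2 -> smooth_on (square r) g1 -> smooth_on (square r) g2 ->
  (forall x y, square r x y -> F (x, y) = (g1 x y, g2 x y)) ->
  pderive_x g1 0 0 * pderive_y g2 0 0 - pderive_y g1 0 0 * pderive_x g2 0 0 <> 0.
Proof.
  intros [HF (theta & Hth & Hper)] Hr Hg1 Hg2 EF Hdet.
  assert (HFs := HF). destruct HFs as (HFsm & _ & HZ & _).
  destruct (smooth_lipschitz_field F HFsm) as [L HL].
  assert (HLp : 0 < L) by apply HL.
  assert (F0 : F origin = (0, 0)) by (apply HZ; [apply origin_in_disk | reflexivity]).
  assert (S0 : square r 0 0) by (split; rewrite Rabs_R0; lra).
  assert (E0 := EF 0 0 S0). change (0, 0) with origin in E0 at 1. rewrite F0 in E0.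
  injection E0 as Z1 Z2.
  destruct (smooth_extension theta origin Hth origin_in_disk) as (h & dh & Hdh & Hh & Eh).
  assert (Ch : continuity_2d_pt h 0 0).
  { apply (smooth_on_continuity _ _ _ _ Hh). split; simpl; rewrite Rminus_diag, Rabs_R0; exact Hdh. }
  destruct (Ch (mkposreal 1 Rlt_0_1)) as [d0 Hd0]. simpl in Hd0.
  (* [h] extends theta near O and varies by less than 1 close to O, so [M] bounds the periods
     there. *)
  set (M := Rabs (h 0 0) + 1).
  set (a := pderive_x g1 0 0) in *. set (b := pderive_y g1 0 0) in *.
  set (c := pderive_x g2 0 0) in *. set (d := pderive_y g2 0 0) in *.
  set (m := a + d).
  set (k := Rabs a + Rabs b + Rabs c + Rabs d + Rabs m + 1).
  set (eps := exp (- ((4 * k + 4) * M)) / 8).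
  assert (Heps : 0 < eps) by (unfold eps; assert (X := exp_pos (- ((4 * k + 4) * M))); lra).
  destruct (smooth_on_continuity _ _ 0 0 (smooth_on_pderive_x _ _ Hg1) S0 (mkposreal eps Heps))
    as [d1 Hd1].
  destruct (smooth_on_continuity _ _ 0 0 (smooth_on_pderive_y _ _ Hg1) S0 (mkposreal eps Heps))
    as [d2 Hd2].
  destruct (smooth_on_continuity _ _ 0 0 (smooth_on_pderive_x _ _ Hg2) S0 (mkposreal eps Heps))
    as [d3 Hd3].
  destruct (smooth_on_continuity _ _ 0 0 (smooth_on_pderive_y _ _ Hg2) S0 (mkposreal eps Heps))
    as [d4 Hd4].
  simpl in Hd1, Hd2, Hd3, Hd4.
  (* In this square the extensions of F and theta are available, periods are at most [M], and the
     four partial derivatives are within [eps] of their values at O. *)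
  set (r0 := Rmin r (Rmin (Rmin dh d0) (Rmin (Rmin d1 d2) (Rmin d3 d4)))).
  assert (Hr0 : 0 < r0).
  { unfold r0. repeat apply Rmin_case; try apply cond_pos; lra. }
  assert (Hall : r0 <= r /\ r0 <= dh /\ r0 <= d0 /\ r0 <= d1 /\ r0 <= d2 /\ r0 <= d3 /\ r0 <= d4).
  { unfold r0. set (A := Rmin (Rmin dh d0) (Rmin (Rmin d1 d2) (Rmin d3 d4))).
    assert (X0 := Rmin_l r A). assert (X1 := Rmin_r r A).
    assert (X2 := Rmin_l (Rmin dh d0) (Rmin (Rmin d1 d2) (Rmin d3 d4))).
    assert (X3 := Rmin_r (Rmin dh d0) (Rmin (Rmin d1 d2) (Rmin d3 d4))).
    assert (X4 := Rmin_l dh d0). assert (X5 := Rmin_r dh d0).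
    assert (X6 := Rmin_l (Rmin d1 d2) (Rmin d3 d4)). assert (X7 := Rmin_r (Rmin d1 d2) (Rmin d3 d4)).
    assert (X8 := Rmin_l d1 d2). assert (X9 := Rmin_r d1 d2).
    assert (X10 := Rmin_l d3 d4). assert (X11 := Rmin_r d3 d4).
    fold A in X2, X3. lra. }
  (* Within time [M] the distance to O grows at most by exp(2 L M), the square root of the factor in
     [curve_growth]. A start at distance at most sqrt 2 rho then stays within r0 / sqrt 2 of O. *)
  set (rho := r0 * exp (- (2 * L * M)) / 2).
  assert (HM : 1 <= M) by (unfold M; assert (X := Rabs_pos (h 0 0)); lra).
  assert (Hrho : 0 < rho).
  { unfold rho. assert (X := exp_pos (- (2 * L * M))).
    assert (0 < r0 * exp (- (2 * L * M))) by now apply Rmult_lt_0_compat. lra. }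
  assert (Hrho' : rho < r0).
  { unfold rho. assert (exp (- (2 * L * M)) <= exp 0).
    { apply exp_nondecreasing. assert (0 < L * M) by (apply Rmult_lt_0_compat; lra). lra. }
    rewrite exp_0 in H. nra. }
  destruct (almost_eigenvector_exists r g1 g2 eps rho Hg1 Hg2 ltac:(lra) Heps Hrho)
    as (z1 & z2 & [Hz1 Hz2] & Hne & V1 & V2); try (symmetry; assumption); trivial.
  fold a b c d m in V1, V2.
  assert (Sz : square r z1 z2) by (split; lra).
  assert (Dz : disk (z1, z2)) by (apply (square_in_disk r); [lra | exact Sz]).
  destruct (Hper (z1, z2) Dz Hne) as (gamma & [Hg G0] & HT & HpT & _).
  apply integral_curve_curve in Hg.
  set (T := theta (z1, z2)) in *.
  assert (HTM : T <= M).
  { unfold T. rewrite Eh; trivial.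
    - simpl. assert (X : Rabs (h z1 z2 - h 0 0) < 1) by (apply Hd0; rewrite Rminus_0_r; lra).
      apply Rabs_lt_shift in X. assert (Y := Rle_abs (h z1 z2)). unfold M. lra.
    - split; simpl; rewrite Rminus_0_r; lra. }
  assert (Hstay : forall t, 0 <= t <= T -> square r0 (fst (gamma t)) (snd (gamma t))).
  { intros t Ht.
    assert (G := curve_growth F L gamma t HL F0 Hg ltac:(lra)).
    rewrite G0 in G. cbn [fst snd] in G.
    assert (Hmono : exp (4 * L * t) <= exp (4 * L * M)) by (apply exp_nondecreasing, Rmult_le_compat_l; lra).
    assert (Q1 : z1 ^ 2 + z2 ^ 2 <= 2 * rho ^ 2).
    { rewrite <- (pow2_abs z1), <- (pow2_abs z2).
      assert (A1 := Rabs_pos z1). assert (A2 := Rabs_pos z2).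
      assert (Rabs z1 ^ 2 <= rho ^ 2) by (apply pow_incr; lra).
      assert (Rabs z2 ^ 2 <= rho ^ 2) by (apply pow_incr; lra). lra. }
    assert (Q2 : 2 * rho ^ 2 * exp (4 * L * M) = r0 ^ 2 / 2).
    { unfold rho. replace (4 * L * M) with (2 * L * M + 2 * L * M) by ring.
      rewrite exp_plus, exp_Ropp. field. apply Rgt_not_eq, exp_pos. }
    assert (Q3 : (z1 ^ 2 + z2 ^ 2) * exp (4 * L * t) <= 2 * rho ^ 2 * exp (4 * L * M)).
    { apply Rmult_le_compat; trivial; [| left; apply exp_pos].
      apply Rplus_le_le_0_compat; apply pow2_ge_0. }
    assert (Q4 : 0 < r0 ^ 2) by now apply pow_lt.
    assert (Hsq : forall x, x ^ 2 < r0 ^ 2 -> Rabs x < r0).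
    { intros x Hx. rewrite <- (pow2_abs x) in Hx. apply Rnot_le_lt. intros C.
      assert (r0 ^ 2 <= Rabs x ^ 2) by (apply pow_incr; lra). lra. }
    assert (S1 := pow2_ge_0 (fst (gamma t))). assert (S2 := pow2_ge_0 (snd (gamma t))).
    split; apply Hsq; lra. }
  set (x := fun t => fst (gamma t)). set (y := fun t => snd (gamma t)).
  assert (Hsr : forall t, 0 <= t <= T -> square r (x t) (y t)).
  { intros t Ht. destruct (Hstay t Ht) as [A B]. unfold x, y. split; lra. }
  assert (Hxy : forall t, 0 <= t <= T ->
    is_derive x t (g1 (x t) (y t)) /\ is_derive y t (g2 (x t) (y t))).
  { intros t Ht. destruct (curve_is_derive F gamma t Hg) as [A B].
    assert (E := EF _ _ (Hsr t Ht)). unfold x, y in E. rewrite <- surjective_pairing in E.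
    rewrite E in A, B. now split. }
  assert (Hadv := almost_eigenvector_advance a b c d m M T eps x y
    (fun t => g1 (x t) (y t)) (fun t => g2 (x t) (y t))
    (fun t => pderive_x g1 (x t) (y t)) (fun t => pderive_y g1 (x t) (y t))
    (fun t => pderive_x g2 (x t) (y t)) (fun t => pderive_y g2 (x t) (y t))).
  assert (x0 : x 0 = z1) by (unfold x; now rewrite G0).
  assert (y0 : y 0 = z2) by (unfold y; now rewrite G0).
  assert (ET : gamma T = gamma 0) by (rewrite <- (HpT 0); f_equal; ring).
  assert (xT : x T = z1) by (unfold x; rewrite ET; exact x0).
  assert (yT : y T = z2) by (unfold y; rewrite ET; exact y0).
  cbv zeta beta in Hadv. rewrite x0, y0, xT, yT in Hadv.
  apply (Rlt_irrefl (g1 z1 z2 * z1 + g2 z1 z2 * z2)).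
  apply Hadv; trivial.
  - lra.
  - intros t Ht. now apply Hxy.
  - intros t Ht. now apply Hxy.
  - intros t Ht. destruct (Hxy t Ht).
    apply (smooth_on_is_derive_comp (square r)); trivial; [apply open_square | now apply Hsr].
  - intros t Ht. destruct (Hxy t Ht).
    apply (smooth_on_is_derive_comp (square r)); trivial; [apply open_square | now apply Hsr].
  - intros t Ht. destruct (Hstay t Ht) as [A B]. fold (x t) in A. fold (y t) in B.
    assert (A' : Rabs (x t - 0) < r0) by (now rewrite Rminus_0_r).
    assert (B' : Rabs (y t - 0) < r0) by (now rewrite Rminus_0_r).
    repeat split; left; [apply Hd1 | apply Hd2 | apply Hd3 | apply Hd4]; lra.
  - assert (P1 := Rabs_pos (g1 z1 z2)). assert (P2 := Rabs_pos (g2 z1 z2)).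
    destruct (Rlt_dec 0 (Rabs (g1 z1 z2) + Rabs (g2 z1 z2))) as [H | H]; [exact H | exfalso].
    apply Hne, HZ; [exact Dz |]. rewrite EF by exact Sz.
    assert (W1 : g1 z1 z2 = 0) by (apply Rabs_eq_0; lra).
    assert (W2 : g2 z1 z2 = 0) by (apply Rabs_eq_0; lra). now rewrite W1, W2.
Qed.

(** * The quotient of the two fields *)

Lemma continuous_punctured_zero (p : R -> R) (r : R) :
  0 < r -> continuous p 0 -> (forall z, z <> 0 -> Rabs z < r -> p z = 0) -> p 0 = 0.
Proof.
  intros Hr Hc Hz. apply continuity_pt_filterlim in Hc.
  apply NNPP. intros Hne.
  destruct (continuity_pt_eps_inv p 0 (Rabs (p 0)) Hc (Rabs_pos_lt _ Hne)) as (d & Hd & K).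
  assert (M1 := Rmin_l d r). assert (M2 := Rmin_r d r).
  assert (M3 : 0 < Rmin d r) by now apply Rmin_case.
  assert (A : Rabs (Rmin d r / 2) = Rmin d r / 2) by (apply Rabs_pos_eq; lra).
  specialize (K (Rmin d r / 2)). rewrite Rminus_0_r, A in K.
  rewrite (Hz (Rmin d r / 2)) in K; [| lra | rewrite A; lra].
  rewrite Rminus_0_l, Rabs_Ropp in K. specialize (K ltac:(lra)). lra.
Qed.

(** The relation u y = v x can be divided by y only off the axis y = 0, and by x only off the axis x
    = 0; the excluded points are recovered by continuity along a line. *)
Lemma radial_field_factor (r : R) (u v : R -> R -> R) :
  0 < r -> smooth_on (square r) u -> smooth_on (square r) v ->
  (forall x y, square r x y -> u x y * y = v x y * x) ->
  exists nu, smooth_on (square r) nu /\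
    forall x y, square r x y -> u x y = nu x y * x /\ v x y = nu x y * y.
Proof.
  intros Hr Hu Hv Huv.
  assert (R0 : Rabs 0 < r) by now rewrite Rabs_R0.
  assert (Hu0 : forall y, Rabs y < r -> u 0 y = 0).
  { assert (Hne : forall y, y <> 0 -> Rabs y < r -> u 0 y = 0).
    { intros y Hy Hyr. assert (E := Huv 0 y (conj R0 Hyr)). rewrite Rmult_0_r in E.
      apply Rmult_integral in E. tauto. }
    intros y Hy. destruct (Req_dec y 0) as [-> | Hy0]; [| now apply Hne].
    apply (continuous_punctured_zero (fun y => u 0 y) r); trivial.
    apply continuity_2d_pt_slice_y. now apply (smooth_on_continuity (square r)). }
  destruct (hadamard_x r u Hu) as (nu & Hnu & E).
  exists nu. split; [exact Hnu |].
  assert (Eu : forall x y, square r x y -> u x y = nu x y * x).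
  { intros x y [Hx Hy]. rewrite E, Hu0 by (trivial; now split). ring. }
  assert (Ev : forall x y, x <> 0 -> square r x y -> v x y = nu x y * y).
  { intros x y Hx0 Hxy. assert (H := Huv x y Hxy). rewrite (Eu x y Hxy) in H.
    apply (Rmult_eq_reg_r x); [rewrite <- H; ring | exact Hx0]. }
  intros x y [Hx Hy]. split; [now apply Eu |].
  destruct (Req_dec x 0) as [-> | Hx0]; [| now apply Ev].
  apply Rminus_diag_uniq.
  apply (continuous_punctured_zero (fun x => v x y - nu x y * y) r); trivial.
  - apply (continuity_2d_pt_slice_x (fun x y => v x y - nu x y * y)).
    apply continuity_2d_pt_minus; [now apply (smooth_on_continuity (square r)) |].
    apply continuity_2d_pt_mult; [now apply (smooth_on_continuity (square r)) |].
    apply continuity_2d_pt_id2.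
  - intros z Hz Hzr. rewrite (Ev z y Hz); [ring | now split].
Qed.

(** Identifies the Hadamard coefficients at O with the Jacobian of the field, so that nondegeneracy
    of the linear part makes the matrix A(z) invertible near O. *)
Lemma hadamard_coefficients (r : R) (g k l : R -> R -> R) :
  0 < r -> smooth_on (square r) k -> smooth_on (square r) l ->
  (forall x y, square r x y -> g x y = k x y * x + l x y * y) ->
  pderive_x g 0 0 = k 0 0 /\ pderive_y g 0 0 = l 0 0.
Proof.
  intros Hr Hk Hl E.
  assert (S0 : square r 0 0) by (split; now rewrite Rabs_R0).
  destruct (open_square r 0 0 S0) as [d Hd].
  assert (Z : forall w, Rabs (w - w) < d) by (intros; rewrite Rminus_diag, Rabs_R0; apply cond_pos).
  split.
  - apply is_derive_unique.
    apply is_derive_ext_loc with (fun x => k x 0 * x + l x 0 * 0).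
    + exists d. intros x Hx. symmetry. apply E, Hd; [exact Hx | apply Z].
    + assert (D1 := smooth_on_is_derive_x _ k 0 0 Hk S0).
      assert (D2 := smooth_on_is_derive_x _ l 0 0 Hl S0).
      auto_derive; [split; [now eexists; exact D1 | split; [now eexists; exact D2 | trivial]] | ring].
  - apply is_derive_unique.
    apply is_derive_ext_loc with (fun y => k 0 y * 0 + l 0 y * y).
    + exists d. intros y Hy. symmetry. apply E, Hd; [apply Z | exact Hy].
    + assert (D1 := smooth_on_is_derive_y _ k 0 0 Hk S0).
      assert (D2 := smooth_on_is_derive_y _ l 0 0 Hl S0).
      auto_derive; [split; [now eexists; exact D1 | split; [now eexists; exact D2 | trivial]] | ring].
Qed.

Lemma smooth_extension_origin (X : vector_field) :
  smooth_vector_field X ->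
  exists r, 0 < r /\ exists g1 g2, smooth_on (square r) g1 /\ smooth_on (square r) g2 /\
    forall x y, square r x y -> disk (x, y) -> X (x, y) = (g1 x y, g2 x y).
Proof.
  intros [H1 H2].
  destruct (smooth_extension _ origin H1 origin_in_disk) as (g1 & d1 & Hd1 & Hg1 & E1).
  destruct (smooth_extension _ origin H2 origin_in_disk) as (g2 & d2 & Hd2 & Hg2 & E2).
  assert (M1 := Rmin_l d1 d2). assert (M2 := Rmin_r d1 d2).
  assert (Hn : forall d x y, Rmin d1 d2 <= d -> square (Rmin d1 d2) x y -> near d origin (x, y)).
  { intros d x y Hd [Hx Hy]. split; simpl; rewrite Rminus_0_r; lra. }
  exists (Rmin d1 d2). split; [now apply Rmin_case |]. exists g1, g2. split; [| split].
  - apply (smooth_on_subset _ _ g1 (fun x y => Hn d1 x y M1) Hg1).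
  - apply (smooth_on_subset _ _ g2 (fun x y => Hn d2 x y M2) Hg2).
  - intros x y Hxy Dxy. rewrite (surjective_pairing (X (x, y))). f_equal.
    + now apply (E1 (x, y)), Dxy; apply Hn.
    + now apply (E2 (x, y)), Dxy; apply Hn.
Qed.

Lemma square_le (r s x y : R) : r <= s -> square r x y -> square s x y.
Proof. intros H [Hx Hy]; split; lra. Qed.

Lemma quotient_at_origin (F F' : vector_field) :
  PTC F -> smooth_vector_field F' ->
  (forall p, disk p -> cross (F' p) (F p) = 0) ->
  exists r nu, 0 < r <= / 2 /\ smooth_on (square r) nu /\
    forall x y, square r x y -> F' (x, y) = (nu x y * fst (F (x, y)), nu x y * snd (F (x, y))).
Proof.
  intros HF HF' Hcross.
  destruct (smooth_extension_origin F) as (ra & Hra & g1 & g2 & Hg1 & Hg2 & EF); [apply HF |].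
  destruct (smooth_extension_origin F' HF') as (rb & Hrb & h1 & h2 & Hh1 & Hh2 & EF').
  (* A square of half-side at most 1/2 lies in the disk, so the fields agree with their extensions
     on all of it. *)
  set (r := Rmin (Rmin ra rb) (/ 2)).
  assert (M1 := Rmin_l (Rmin ra rb) (/ 2)). assert (M2 := Rmin_r (Rmin ra rb) (/ 2)).
  assert (M3 := Rmin_l ra rb). assert (M4 := Rmin_r ra rb). fold r in M1, M2.
  assert (Hr : 0 < r) by (unfold r; repeat apply Rmin_case; lra).
  assert (Sa : forall x y, square r x y -> square ra x y) by (intros x y; apply square_le; lra).
  assert (Sb : forall x y, square r x y -> square rb x y) by (intros x y; apply square_le; lra).
  assert (Sd : forall x y, square r x y -> disk (x, y)) by (intros x y; now apply square_in_disk).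
  apply (smooth_on_subset _ (square r)) in Hg1, Hg2; trivial.
  apply (smooth_on_subset _ (square r)) in Hh1, Hh2; trivial.
  assert (EFr : forall x y, square r x y -> F (x, y) = (g1 x y, g2 x y))
    by (intros; apply EF; auto).
  assert (EFr' : forall x y, square r x y -> F' (x, y) = (h1 x y, h2 x y))
    by (intros; apply EF'; auto).
  assert (S0 : square r 0 0) by (split; now rewrite Rabs_R0).
  assert (F0 : F (0, 0) = (0, 0)).
  { destruct HF as [(_ & _ & HZ & _) _]. apply HZ; [apply origin_in_disk | reflexivity]. }
  assert (E0 := EFr 0 0 S0). rewrite F0 in E0. injection E0 as Z1 Z2.
  destruct (hadamard r g1 Hg1) as (k1 & l1 & Hk1 & Hl1 & E1); [now symmetry |].
  destruct (hadamard r g2 Hg2) as (k2 & l2 & Hk2 & Hl2 & E2); [now symmetry |].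
  assert (Hdet := PTC_nondegenerate F r g1 g2 HF (conj Hr M2) Hg1 Hg2 EFr).
  destruct (hadamard_coefficients r g1 k1 l1 Hr Hk1 Hl1 E1) as [P1 P2].
  destruct (hadamard_coefficients r g2 k2 l2 Hr Hk2 Hl2 E2) as [P3 P4].
  rewrite P1, P2, P3, P4 in Hdet.
  set (det := fun x y => k1 x y * l2 x y - l1 x y * k2 x y).
  assert (Or := open_square r).
  assert (Sdet : smooth_on (square r) det)
    by (apply smooth_on_minus; trivial; now apply smooth_on_mult).
  destruct (continuity_2d_pt_neq_0 det 0 0) as [e He];
    [now apply (smooth_on_continuity (square r)) | exact Hdet |].
  set (s := Rmin r e).
  assert (M5 := Rmin_l r e). assert (M6 := Rmin_r r e). fold s in M5, M6.
  assert (Hs : 0 < s) by (unfold s; apply Rmin_case; [exact Hr | apply cond_pos]).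
  assert (Ss : forall x y, square s x y -> square r x y) by (intros x y; now apply square_le).
  assert (Hnz : forall x y, square s x y -> det x y <> 0).
  { intros x y [Hx Hy]. apply He; rewrite Rminus_0_r; lra. }
  assert (Sinv : smooth_on (square s) (fun x y => / det x y)).
  { apply smooth_on_inv; trivial; [apply open_square |].
    now apply (smooth_on_subset (square r)). }
  (* Covers both entries that Cramer's rule gives for A(z)^-1 F'(z). *)
  assert (Sq : forall a b c d, smooth_on (square r) a -> smooth_on (square r) b ->
    smooth_on (square r) c -> smooth_on (square r) d ->
    smooth_on (square s) (fun x y => (a x y * b x y - c x y * d x y) * / det x y)).
  { intros a b c d Ha Hb Hc Hd. apply smooth_on_mult; [apply open_square | | exact Sinv].
    apply (smooth_on_subset (square r)); [exact Ss |].
    apply smooth_on_minus; trivial; now apply smooth_on_mult. }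
  destruct (radial_field_factor s _ _ Hs (Sq l2 h1 l1 h2 Hl2 Hh1 Hl1 Hh2)
    (Sq k1 h2 k2 h1 Hk1 Hh2 Hk2 Hh1)) as (nu & Hnu & Enu).
  (* For (u, v) = A(z)^-1 F'(z), the difference u y - v x is the cross product of F' and F = A(z) z
     divided by det A(z); hence it vanishes. *)
  { intros x y Hxy. assert (C := Hcross (x, y) (Sd x y (Ss x y Hxy))).
    rewrite EFr, EFr' in C by auto. unfold cross in C; cbn [fst snd] in C.
    rewrite (E1 x y), (E2 x y) in C by auto.
    apply Rminus_diag_uniq.
    match goal with |- ?lhs = 0 => replace lhs with ((h1 x y * (k2 x y * x + l2 x y * y)
      - h2 x y * (k1 x y * x + l1 x y * y)) * / det x y) by ring end.
    rewrite C. ring. }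
  exists s, nu. split; [lra |]. split; [exact Hnu |].
  intros x y Hxy. destruct (Enu x y Hxy) as [N1 N2].
  rewrite EFr, EFr' by auto. cbn [fst snd]. rewrite (E1 x y), (E2 x y) by auto.
  assert (Hd := Hnz x y Hxy). f_equal.
  (* F' = A(z)(u, v) = nu A(z) z = nu F, one coordinate at a time. *)
  - replace (nu x y * (k1 x y * x + l1 x y * y))
      with (k1 x y * (nu x y * x) + l1 x y * (nu x y * y)) by ring.
    rewrite <- N1, <- N2. unfold det in *. field. exact Hd.
  - replace (nu x y * (k2 x y * x + l2 x y * y))
      with (k2 x y * (nu x y * x) + l2 x y * (nu x y * y)) by ring.
    rewrite <- N1, <- N2. unfold det in *. field. exact Hd.
Qed.

(** * Gluing the quotient away from O with the one at O *)

Lemma smooth_of_local_extensions (f : R * R -> R) :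
  (forall p, disk p -> exists U g, open_2d U /\ U (fst p) (snd p) /\ smooth_on U g /\
    forall x y, U x y -> disk (x, y) -> f (x, y) = g x y) ->
  smooth f.
Proof.
  intros H p Dp. destruct (H p Dp) as (U & g & HU & Up & Hg & E).
  exists g. destruct (HU _ _ Up) as [d Hd]. exists d.
  intros [x y] [Hx Hy]. assert (Uxy : U x y) by now apply Hd.
  split; [now apply Hg | now apply E].
Qed.

Lemma open_2d_nonzero (U : R -> R -> Prop) (g : R -> R -> R) :
  open_2d U -> smooth_on U g -> open_2d (fun x y => U x y /\ g x y <> 0).
Proof.
  intros HU Hg x y [Hu Hn]. destruct (HU x y Hu) as [d Hd].
  destruct (continuity_2d_pt_neq_0 g x y (smooth_on_continuity U g x y Hg Hu) Hn) as [e He].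
  assert (M1 := Rmin_l d e). assert (M2 := Rmin_r d e).
  assert (Hm : 0 < Rmin d e) by (apply Rmin_case; apply cond_pos).
  exists (mkposreal _ Hm). simpl. intros u v Hx Hy. split; [apply Hd | apply He]; lra.
Qed.

Definition quotient (F F' : vector_field) (p : R * R) : R :=
  (fst (F' p) * fst (F p) + snd (F' p) * snd (F p)) * / (fst (F p) * fst (F p) + snd (F p) * snd (F p)).

Lemma sum_squares_neq_0 (a b : R) : (a, b) <> (0, 0) -> a * a + b * b <> 0.
Proof.
  intros H E. apply H. assert (A := Rle_0_sqr a). assert (B := Rle_0_sqr b).
  unfold Rsqr in A, B. f_equal; nra.
Qed.

Lemma quotient_spec (F F' : vector_field) (p : R * R) :
  F p <> (0, 0) -> cross (F' p) (F p) = 0 -> F' p = scal (quotient F F' p) (F p).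
Proof.
  intros HF Hc. unfold quotient, cross in *.
  destruct (F p) as [a b]. destruct (F' p) as [c d]. cbn [fst snd] in *.
  assert (Hn := sum_squares_neq_0 a b HF).
  apply injective_projections; cbn; unfold mult; simpl; set (w := / (a * a + b * b)).
  - transitivity ((c * a * a + b * (d * a)) * w); [| ring].
    replace (d * a) with (c * b) by lra. unfold w. field. exact Hn.
  - transitivity ((d * b * b + a * (c * b)) * w); [| ring].
    replace (c * b) with (d * a) by lra. unfold w. field. exact Hn.
Qed.

(** The multiplier is unique where F does not vanish; this makes the local factor near O agree with
    the global formula off O. *)
Lemma quotient_scal (F F' : vector_field) (p : R * R) (c : R) :
  F p <> (0, 0) -> F' p = (c * fst (F p), c * snd (F p)) -> quotient F F' p = c.
Proof.
  intros HF E. unfold quotient. rewrite E. destruct (F p) as [a b]. cbn [fst snd].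
  assert (Hn := sum_squares_neq_0 a b HF). field. exact Hn.
Qed.

(** The extension of |F|^2 must also be nonzero at points outside the disk, where nothing is known
    about it; hence [U] is cut down to its nonvanishing locus, open by continuity. *)
Lemma quotient_local_extension (F F' : vector_field) (p : R * R) :
  smooth_vector_field F -> smooth_vector_field F' -> disk p -> F p <> (0, 0) ->
  exists U g, open_2d U /\ U (fst p) (snd p) /\ smooth_on U g /\
    forall x y, U x y -> disk (x, y) -> F (x, y) <> (0, 0) /\ quotient F F' (x, y) = g x y.
Proof.
  intros [HF1 HF2] [HF1' HF2'] Dp Hp.
  destruct (smooth_extension _ p HF1 Dp) as (g1 & d1 & Hd1 & Hg1 & E1).
  destruct (smooth_extension _ p HF2 Dp) as (g2 & d2 & Hd2 & Hg2 & E2).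
  destruct (smooth_extension _ p HF1' Dp) as (h1 & d3 & Hd3 & Hh1 & E3).
  destruct (smooth_extension _ p HF2' Dp) as (h2 & d4 & Hd4 & Hh2 & E4).
  set (d := Rmin (Rmin d1 d2) (Rmin d3 d4)).
  assert (Hd : 0 < d) by (unfold d; repeat apply Rmin_case; assumption).
  assert (Hle : d <= d1 /\ d <= d2 /\ d <= d3 /\ d <= d4).
  { assert (X1 := Rmin_l (Rmin d1 d2) (Rmin d3 d4)). assert (X2 := Rmin_r (Rmin d1 d2) (Rmin d3 d4)).
    assert (X3 := Rmin_l d1 d2). assert (X4 := Rmin_r d1 d2).
    assert (X5 := Rmin_l d3 d4). assert (X6 := Rmin_r d3 d4). fold d in X1, X2. lra. }
  destruct Hle as (L1 & L2 & L3 & L4).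
  assert (Hn : forall e q, d <= e -> near d p q -> near e p q).
  { intros e q He [Q1 Q2]. split; lra. }
  set (V := fun x y => near d p (x, y)).
  assert (Sub : forall e g, d <= e -> smooth_on (fun x y => near e p (x, y)) g -> smooth_on V g).
  { intros e g He. apply smooth_on_subset. intros x y. now apply Hn. }
  apply Sub in Hg1, Hg2, Hh1, Hh2; trivial.
  assert (OV : open_2d V) by apply open_near.
  set (n := fun x y => g1 x y * g1 x y + g2 x y * g2 x y).
  assert (Sn : smooth_on V n) by (apply smooth_on_plus; trivial; now apply smooth_on_mult).
  exists (fun x y => V x y /\ n x y <> 0),
    (fun x y => (h1 x y * g1 x y + h2 x y * g2 x y) * / n x y).
  assert (OU : open_2d (fun x y => V x y /\ n x y <> 0)) by now apply open_2d_nonzero.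
  assert (Hsub : forall g, smooth_on V g -> smooth_on (fun x y => V x y /\ n x y <> 0) g)
    by (intros g; apply smooth_on_subset; now intros x y [H _]).
  assert (EV : forall x y, V x y -> disk (x, y) ->
    F (x, y) = (g1 x y, g2 x y) /\ F' (x, y) = (h1 x y, h2 x y)).
  { intros x y Vxy Dxy. rewrite (surjective_pairing (F (x, y))), (surjective_pairing (F' (x, y))).
    rewrite (E1 (x, y)), (E2 (x, y)), (E3 (x, y)), (E4 (x, y)) by (trivial; now apply Hn).
    now split. }
  split; [exact OU |]. split; [| split].
  - assert (Vp : V (fst p) (snd p)).
    { split; simpl; rewrite Rminus_diag, Rabs_R0; exact Hd. }
    split; [exact Vp |]. apply sum_squares_neq_0.
    destruct (EV (fst p) (snd p) Vp) as [<- _]; now rewrite <- surjective_pairing.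
  - apply smooth_on_mult; trivial.
    + apply Hsub. apply smooth_on_plus; trivial; now apply smooth_on_mult.
    + apply smooth_on_inv; trivial; [now apply Hsub | now intros x y [_ H]].
  - intros x y [Vxy Hnz] Dxy. destruct (EV x y Vxy Dxy) as [EF EF'].
    unfold quotient. rewrite EF, EF'. cbn [fst snd]. split; [| reflexivity].
    intros C. injection C as C1 C2. apply Hnz. unfold n. rewrite C1, C2. ring.
Qed.

Theorem claim11p1 : forall F : vector_field, PTC F -> parameter_rigid F.
Proof.
  intros F HF F' HF' Horb.
  assert (Hcross := cross_zero_on_disk F F' HF HF' Horb).
  destruct (quotient_at_origin F F' HF HF' Hcross) as (r & nu0 & Hr & Hnu0 & E0).
  destruct HF as [(HFs & _ & HZ & _) _].
  assert (F0 : F origin = (0, 0)) by (apply HZ; [apply origin_in_disk | reflexivity]).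
  (* At O the formula for the quotient divides by zero; the value there is imposed by the smooth
     local factor. *)
  set (nu := fun p => if excluded_middle_informative (p = origin)
    then nu0 0 0 else quotient F F' p).
  assert (Hnu : forall p, p <> origin -> nu p = quotient F F' p).
  { intros p Hp. unfold nu. now destruct (excluded_middle_informative (p = origin)). }
  assert (Hnuo : nu origin = nu0 0 0).
  { unfold nu. now destruct (excluded_middle_informative (origin = origin)). }
  exists nu. split.
  - apply smooth_of_local_extensions. intros p Dp.
    destruct (classic (p = origin)) as [-> | Hp].
    + exists (square r), nu0.
      split; [apply open_square |].
      split; [split; simpl; rewrite Rabs_R0; lra |].
      split; [exact Hnu0 |].
      intros x y Hxy Dxy. destruct (classic ((x, y) = origin)) as [E | Hne].
      * rewrite E, Hnuo. now injection E as -> ->.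
      * rewrite (Hnu _ Hne). apply quotient_scal; [| now apply E0].
        intros C. apply Hne. now apply HZ.
    + destruct (quotient_local_extension F F' p HFs HF' Dp) as (U & g & HU & Up & Hg & E).
      { intros C. apply Hp. now apply HZ. }
      exists U, g. split; [exact HU |]. split; [exact Up |]. split; [exact Hg |].
      intros x y Uxy Dxy. destruct (E x y Uxy Dxy) as [Hne <-].
      apply Hnu. intros C. apply Hne. now apply HZ.
  - intros p Dp. destruct (classic (p = origin)) as [-> | Hp].
    (* At O both sides are zero: the local factorisation gives F'(O) = nu0(0, 0) F(O) = 0. *)
    + rewrite F0. change origin with (0, 0) at 1.
      rewrite E0 by (split; rewrite Rabs_R0; lra).
      change (F (0, 0)) with (F origin). rewrite F0.
      apply injective_projections; cbn; unfold mult; simpl; now rewrite !Rmult_0_r.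
    + rewrite (Hnu p Hp). apply quotient_spec; [| now apply Hcross].
      intros C. apply Hp. now apply HZ.
Qed.
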